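(* Let $n\ge1$, let $B_1\in X_n(E)$ and let $B=\begin{pmatrix} B_1 & 0 \\ 0 & \pi^{-1}1_n \end{pmatrix}\in X_{2n}(E)$. Then $$\mathcal{J}_n^n(B)=\frac{1}{W_{n,n}(A_n,0)}\Big\{W'_{n,n}(B,0)-\sum_{0\le i\le n-1}\beta_i^nW_{n,i}(B,0)\Big\}=\frac{\alpha'(1_n,B_1)}{\alpha(1_n,1_n)}.$$
   Context: Let $p$ be an odd prime, $F$ a finite unramified extension of $\mathbb{Q}_p$ with ring of integers $O_F$, residue field $\mathbb{F}_q$ and uniformizer $\pi$. Let $E/F$ be the unramified quadratic extension, $O_E$ its ring of integers, ${}^*$ the nontrivial automorphism of $E/F$. For a matrix $X$ over $E$, ${}^tX^*$ is the conjugate transpose. Put $V_k(E)=\{Y\in M_{k,k}(E):{}^tY^*=Y\}$, $X_k(E)=V_k(E)\cap GL_k(E)$, $V_k(O_E)=V_k(E)\cap M_{k,k}(O_E)$; $\langle X,Y\rangle=\mathrm{Tr}(XY)$; $A[X]={}^tX^*AX$. Let $\psi:F\to\mathbb{C}^\times$ be an additive character trivial on $O_F$ but not on $\pi^{-1}O_F$. For $0\le t\le n$, $0\le h\le 2n$ and integers $r\ge 0$ let $A_t=\mathrm{diag}(1_{2n-t},\pi^{-1}1_t)$, $A_t^{[r]}=\mathrm{diag}(A_t,1_{2r})$, and let $1_{h,t}^{[r]}$ be the characteristic function of the set of $X\in M_{2n+2r,2n}(O_E)$ whose entries in rows $2n-t+1,\dots,2n$ and columns $1,\dots,2n-h$ lie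 in $\pi O_E$. For $B\in X_{2n}(E)$ define $$W_{h,t}(B,r)=\int_{V_{2n}(E)}\int_{M_{2n+2r,2n}(E)}\psi(\langle Y,A_t^{[r]}[X]-B\rangle)\,1_{h,t}^{[r]}(X)\,dX\,dY,$$ with Haar measures giving $V_{2n}(O_E)$ and $M_{2n+2r,2n}(O_E)$ volume $1$ (the outer integral being understood as the limit of the integrals over $\pi^{-k}V_{2n}(O_E)$, $k\to\infty$). As a function of $r$ it is a polynomial in $x=(-q)^{-2r}$; $W_{h,t}(B,0)$ is its value at $r=0$ (i.e. $x=1$) and $W'_{h,t}(B,0)=-\frac{d}{dx}W_{h,t}(B,r)\big|_{x=1}$. For $X=\begin{pmatrix} A & B \\ C & D \end{pmatrix}\in X_{2n}(E)$ with $A$ of size $(2n-h)\times(2n-h)$ and $D$ of size $h\times h$, set $X^{\vee_h}=\begin{pmatrix} \pi D & C \\ B & \pi^{-1}A \end{pmatrix}$. The constants $\beta_i^h,\beta_j^{2n-h}$ ($0\le i,j\le n-1$) and $\delta_h$ are the unique constants such that for all $B\in X_{2n}(E)$ $$W_{h,n}'(B,0)-W_{2n-h,n}'(B^{\vee_h},0)=\sum_{i=0}^{n-1}\beta_i^hW_{h,i}(B,0)-\sum_{j=0}^{n-1}\beta_j^{2n-h}W_{2n-h,j}(B^{\vee_h},0)+\delta_hW_{h,n}(B,0).$$ For $0\le h\le 2n$ define $\mathcal{J}_h^n(B)=\frac{1}{W_{n,n}(A_n,0)}\{W'_{h,n}(B,0)-\sum_{0\le i\le n-1}\beta_i^hW_{h,i}(B,0)\}$.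 Representation densities: for $A\in V_m(O_E)$ and a hermitian $k\times k$ matrix $B$ over $E$, $\alpha(A,B)=\lim_{d\to\infty}q^{-dk(2m-k)}\,\#\{x\in M_{m,k}(O_E/\pi^dO_E): A[x]\equiv B \bmod \pi^d\}$ (so it is $0$ if $B$ is not integral). As a function of $r$, $\alpha(\mathrm{diag}(A,1_{2r}),B)$ is a polynomial in $x=(-q)^{-2r}$, and $\alpha'(A,B)=-\frac{d}{dx}\alpha(\mathrm{diag}(A,1_{2r}),B)\big|_{x=1}$. *)

(* Defs.v *)
From HB Require Import structures.
From mathcomp Require Import all_boot all_order all_algebra.
From mathcomp Require Import falgebra fieldext.
From mathcomp Require Import finmap complex.
From mathcomp Require Import all_classical all_reals all_analysis.

Set Implicit Arguments.
Unset Strict Implicit.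
Unset Printing Implicit Defensive.

Import Order.TTheory GRing.Theory Num.Theory.
Import numFieldNormedType.Exports.

Local Open Scope classical_set_scope.
Local Open Scope ring_scope.

(* Z_p = lim Z/p^k: the k-th term of a sequence is the representative in
   [0, p^k) of the image in Z/p^k. *)
Record padic_int (p : nat) (hp : prime p) := PadicInt {
  padic_res : nat -> int;
  padic_resP : forall k, padic_res k = (padic_res k.+1 %% (p ^ k)%:Z)%Z }.

Section PadicIntRing.
Context (p : nat) (hp : prime p).
Local Notation Zp := (padic_int hp).
Implicit Types a b c : Zp.

HB.instance Definition _ := gen_eqMixin Zp.
HB.instance Definition _ := gen_choiceMixin Zp.

Lemma padic_eqP a b : padic_res a =1 padic_res b -> a = b.
Proof.
case: a b => [f fP] [g gP] /= /funext fg; rewrite fg in fP *.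
by congr PadicInt; exact: Prop_irrelevance.
Qed.

Lemma padic_res_mod a k : (padic_res a k %% (p ^ k)%:Z)%Z = padic_res a k.
Proof. by rewrite padic_resP modz_mod. Qed.

Let mod_mod (x : int) k : ((x %% (p ^ k.+1)%:Z)%Z %% (p ^ k)%:Z)%Z =
  (x %% (p ^ k)%:Z)%Z.
Proof.
by rewrite [in RHS](divz_eq x (p ^ k.+1)%:Z) expnS PoszM mulrA modzMDl.
Qed.

Let of_intP (z : int) k :
  (z %% (p ^ k)%:Z)%Z = ((z %% (p ^ k.+1)%:Z)%Z %% (p ^ k)%:Z)%Z.
Proof. by rewrite mod_mod. Qed.
Definition padic_of_int (z : int) : Zp := PadicInt hp (of_intP z).

Let oppP a k : ((- padic_res a k) %% (p ^ k)%:Z)%Z =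
  (((- padic_res a k.+1) %% (p ^ k.+1)%:Z)%Z %% (p ^ k)%:Z)%Z.
Proof. by rewrite mod_mod [in LHS]padic_resP modzNm. Qed.
Definition padic_opp a : Zp := PadicInt hp (oppP a).

Let addP a b k : ((padic_res a k + padic_res b k) %% (p ^ k)%:Z)%Z =
  (((padic_res a k.+1 + padic_res b k.+1) %% (p ^ k.+1)%:Z)%Z %% (p ^ k)%:Z)%Z.
Proof. by rewrite mod_mod !(padic_resP _ k) modzDm. Qed.
Definition padic_add a b : Zp := PadicInt hp (addP a b).

Let mulP a b k : ((padic_res a k * padic_res b k) %% (p ^ k)%:Z)%Z =
  (((padic_res a k.+1 * padic_res b k.+1) %% (p ^ k.+1)%:Z)%Z %% (p ^ k)%:Z)%Z.
Proof. by rewrite mod_mod !(padic_resP _ k) modzMm. Qed.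
Definition padic_mul a b : Zp := PadicInt hp (mulP a b).

Let addA : associative padic_add.
Proof. by move=> a b c; apply: padic_eqP => k /=; rewrite modzDmr modzDml addrA. Qed.
Let addC : commutative padic_add.
Proof. by move=> a b; apply: padic_eqP => k /=; rewrite addrC. Qed.
Let add0 : left_id (padic_of_int 0) padic_add.
Proof. by move=> a; apply: padic_eqP => k /=; rewrite modzDml add0r padic_res_mod. Qed.
Let addN : left_inverse (padic_of_int 0) padic_opp padic_add.
Proof. by move=> a; apply: padic_eqP => k /=; rewrite modzDml addNr. Qed.
HB.instance Definition _ := GRing.isZmodule.Build Zp addA addC add0 addN.

Let mulA : associative padic_mul.
Proof. by move=> a b c; apply: padic_eqP => k /=; rewrite modzMmr modzMml mulrA. Qed.
Let mulC : commutative padic_mul.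
Proof. by move=> a b; apply: padic_eqP => k /=; rewrite mulrC. Qed.
Let mul1 : left_id (padic_of_int 1) padic_mul.
Proof. by move=> a; apply: padic_eqP => k /=; rewrite modzMml mul1r padic_res_mod. Qed.
Let mulD : left_distributive padic_mul +%R.
Proof.
by move=> a b c; apply: padic_eqP => k /=; rewrite modzMml mulrDl modzDm.
Qed.
Let one_neq0 : padic_of_int 1 != 0.
Proof.
apply/eqP => /(congr1 (fun a => padic_res a 1)) /=.
by rewrite expn1 mod0z modz_small // ltz_nat prime_gt1.
Qed.
HB.instance Definition _ :=
  GRing.Zmodule_isComNzRing.Build Zp mulA mulC mul1 mulD one_neq0.

Definition padic_unit : pred Zp := fun a => `[< exists b, b * a = 1 >].
Definition padic_inv a : Zp :=
  if pselect (exists b, b * a = 1) is left e then projT1 (cid e) else a.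

Let mulV : {in padic_unit, left_inverse 1 padic_inv *%R}.
Proof.
move=> a /asboolP ua; rewrite /padic_inv; case: pselect => // e.
exact: projT2 (cid e).
Qed.
Let unitP a b : b * a = 1 -> padic_unit a.
Proof. by move=> ba; apply/asboolP; exists b. Qed.
Let inv_out : {in [predC padic_unit], padic_inv =1 id}.
Proof.
move=> a /negP ua; rewrite /padic_inv; case: pselect => // e.
by case: ua; apply/asboolP.
Qed.
HB.instance Definition _ :=
  GRing.ComNzRing_hasMulInverse.Build Zp mulV unitP inv_out.

Let padic_dvd a k j : (k <= j)%N ->
  ((p ^ k)%:Z %| padic_res a j)%Z -> padic_res a k = 0.
Proof.
move=> /subnKC <-; elim: (j - k)%N => [|i IHi].
  by rewrite addn0 => /dvdz_mod0P; rewrite padic_res_mod.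
rewrite addnS => dv; apply: IHi; rewrite padic_resP.
rewrite -(rpredDr _ (_ : (p ^ k)%:Z %| (padic_res a (k + i).+1 %/ (p ^ (k + i))%:Z)%Z * (p ^ (k + i))%:Z)%Z).
  by rewrite addrC -divz_eq.
by rewrite dvdz_mull // dvdzE /= expnD dvdn_mulr.
Qed.

Let idom : GRing.integral_domain_axiom Zp.
Proof.
move=> a b ab0; apply/norP => -[/eqP a0 /eqP b0].
have [i ai] : exists i, padic_res a i != 0.
  apply: contrapT => nai; apply: a0; apply: padic_eqP => k /=; rewrite mod0z.
  by apply: contrapT => /eqP ak; apply: nai; exists k.
have [j bj] : exists j, padic_res b j != 0.
  apply: contrapT => nbj; apply: b0; apply: padic_eqP => k /=; rewrite mod0z.
  by apply: contrapT => /eqP bk; apply: nbj; exists k.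
have := congr1 (fun a => padic_res a (i + j)) ab0 => /=; rewrite mod0z => /dvdz_mod0P.
have {ai} : ~~ ((p ^ i)%:Z %| padic_res a (i + j))%Z.
  by apply: contra ai => /(padic_dvd (leq_addr _ _)) ->.
have {bj} : ~~ ((p ^ j)%:Z %| padic_res b (i + j))%Z.
  by apply: contra bj => /(padic_dvd (leq_addl _ _)) ->.
rewrite !dvdzE abszM /=.
set x := `|padic_res a _|%N; set y := `|padic_res b _|%N.
have [->|x0] := posnP x; first by rewrite dvdn0.
have [->|y0] := posnP y; first by rewrite dvdn0.
rewrite !pfactor_dvdn ?muln_gt0 ?x0 // lognM // -!ltnNge => yj xi.
by apply/negP; rewrite -ltnNge -addSn leq_add // ltnW.
Qed.
HB.instance Definition _ := GRing.ComUnitRing_isIntegral.Build Zp idom.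

End PadicIntRing.

Notation padic hp := {fraction (padic_int hp)}.

Section RingsOfIntegers.
Context (p : nat) (hp : prime p).

Definition integers (K : fieldType) (i : padic_int hp -> K) : set K :=
  [set x | integralOver i x].

Definition padic_integers : set (padic hp) := integers (@tofrac _).

Context (F : fieldExtType (padic hp)) (E : fieldExtType F).

Definition base_integers : set F := integers (fun a => (tofrac a)%:A).
Definition ext_integers : set E := integers (fun a => ((tofrac a)%:A)%:A).

End RingsOfIntegers.

Arguments padic_integers {p} hp _ : assert.
Arguments base_integers {p hp} F _ : assert.
Arguments ext_integers {p hp F} E _ : assert.

Definition maximal_ideal (K : fieldType) (O : set K) : set K :=
  [set x | O x /\ ~ exists2 y, O y & x * y = 1].

Definition uniformizer (K : fieldType) (O : set K) (a : K) :=
  maximal_ideal O = [set a * y | y in O].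

(* Ramification index 1; the separability of the residue extension is
   automatic since residue fields of p-adic fields are finite. *)
Definition unramified (K : fieldType) (L : fieldExtType K)
    (OK : set K) (OL : set L) :=
  exists2 a : K, uniformizer OK a & uniformizer OL a%:A.

(* The residue field, as the set of cosets x + m with x in O. *)
Definition residue_field (K : fieldType) (O : set K) : set (set K) :=
  [set [set x + y | y in maximal_ideal O] | x in O].

(* Open sets for the group topology in which the subgroups L k form a basis of
   neighbourhoods of 0. *)
Definition lattice_open (G : zmodType) (L : nat -> set G) : set (set G) :=
  [set U | forall x, U x -> exists k, forall y, L k y -> U (x + y)].

Definition pointed_zmod (G : zmodType) : Type := G.
HB.instance Definition _ (G : zmodType) := GRing.Zmodule.on (pointed_zmod G).
HB.instance Definition _ (G : zmodType) :=
  isPointed.Build (pointed_zmod G) (0 : G).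

Definition borel (G : zmodType) (L : nat -> set G) :=
  g_sigma_algebraType (lattice_open L : set (set (pointed_zmod G))).
HB.instance Definition _ (G : zmodType) (L : nat -> set G) :=
  Measurable.on (borel L).

(* Local finiteness and regularity follow from mu (L 0) = 1 and invariance,
   since L 0 is a compact open subgroup in the intended instances. *)
Definition normalized_haar (R : realType) (G : zmodType) (L : nat -> set G)
    (mu : {measure set (borel L) -> \bar R}) :=
  mu (L 0) = 1%E /\
  forall (x : G) (A : set G), measurable (A : set (borel L)) ->
    mu [set x + y | y in A] = mu A.

Definition cintegral (R : realType) (d : measure_display)
    (T : measurableType d) (mu : {measure set T -> \bar R})
    (D : set T) (f : T -> R[i]) : R[i] :=
  ((\int[mu]_(x in D) complex.Re (f x))
   +i* (\int[mu]_(x in D) complex.Im (f x)))%C.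

Definition climit (R : realType) (u : nat -> R[i]) : R[i] :=
  limn (u : nat -> R[i]^o).

Section HermitianMatrices.
Context (E : fieldType) (conj : {rmorphism E -> E}).

Record hermmx (k : nat) := HermMx {
  hermmx_val :> 'M[E]_k;
  _ : hermmx_val \is (false, conj).-sesqui }.

HB.instance Definition _ k := [isSub for @hermmx_val k].
HB.instance Definition _ k := [Choice of hermmx k by <:].

Lemma sesqui_zmod_closed k :
  zmod_closed ((false, conj).-sesqui : qualifier 0 'M[E]_k).
Proof.
split; first by apply/sesquiP; rewrite trmx0 map_mx0 scaler0.
move=> X Y /sesquiP XE /sesquiP YE; apply/sesquiP.
by rewrite {1}XE {1}YE linearB /= map_mxB scalerBr.
Qed.
HB.instance Definition _ k :=
  GRing.isZmodClosed.Build _ _ (@sesqui_zmod_closed k).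
HB.instance Definition _ k := [SubChoice_isSubZmodule of hermmx k by <:].

(* A[X] *)
Definition herm_act m k (A : 'M[E]_m) (X : 'M[E]_(m, k)) : 'M[E]_k :=
  (X ^t conj)%sesqui *m A *m X.

Definition add_unit_form m (A : 'M[E]_m) (r : nat) : 'M[E]_(m + 2 * r) :=
  block_mx A 0 0 1%:M.

End HermitianMatrices.

Definition mid_ord (n : nat) : 'I_(n + n).+1 :=
  @Ordinal (n + n).+1 n (leq_addr n n).

Section Densities.
Context (p : nat) (hp : prime p).
Context (F : fieldExtType (padic hp)) (E : fieldExtType F).
Context (conj : {rmorphism E -> E}) (pi : F) (q : nat) (R : realType).
Local Notation C := R[i].
Local Notation OE := (ext_integers E).
Local Notation piE := (pi%:A : E).

(* pi^d M_{m,k}(O_E) *)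
Definition mx_lattice m k (d : int) : set 'M[E]_(m, k) :=
  [set X | forall i j, OE (piE ^ (- d) * X i j)].

(* pi^d V_k(O_E) *)
Definition herm_lattice k (d : int) : set (hermmx conj k) :=
  [set Y | mx_lattice d (Y : 'M[E]_k)].

Definition mx_borel m k := borel (fun d : nat => @mx_lattice m k d%:Z).
Definition herm_borel k := borel (fun d : nat => @herm_lattice k d%:Z).

(* X_k(E) *)
Definition nondeg_herm k : set 'M[E]_k :=
  [set X | X \is (false, conj).-sesqui /\ X \in unitmx].

(* For hermitian X and Y the trace of X Y lies in F, viewed inside E. *)
Definition to_base (x : E) : F := xget 0 [set a : F | a%:A = x].
Definition herm_pairing k (X Y : 'M[E]_k) : F := to_base (\tr (X *m Y)).

(* The polynomial P with f r = P((-q)^(-2r)) for all r, which is unique since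
   these arguments are pairwise distinct for q > 1; 0 if there is none. *)
Definition poly_in_x (f : nat -> C) : {poly C} :=
  xget 0 [set P | forall r : nat, f r = P.[(- q%:R) ^- (2 * r)]].
Definition neg_deriv_at1 (f : nat -> C) : C := - ((poly_in_x f)^`()).[1].

(* The classes x + pi^d M_{m,k}(O_E) of integral x with A[x] = B mod pi^d. *)
Definition rep_mod m k (A : 'M[E]_m) (B : 'M[E]_k) (d : nat) :
    set (set 'M[E]_(m, k)) :=
  [set [set x + y | y in mx_lattice d%:Z] | x in
    [set x | mx_lattice 0 x /\ mx_lattice d%:Z (herm_act conj A x - B)]].

Definition alpha m k (A : 'M[E]_m) (B : 'M[E]_k) : C :=
  climit (fun d : nat =>
    q%:R ^ (- (d%:Z * k%:Z * (2 * m%:Z - k%:Z))) *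
    (#|` fset_set (rep_mod A B d)|)%:R).

Definition alpha' m k (A : 'M[E]_m) (B : 'M[E]_k) : C :=
  neg_deriv_at1 (fun r => alpha (add_unit_form A r) B).

(* 2n is written n + n throughout. *)
Context (n : nat) (psi : F -> C).
Context (mu : forall r : nat,
  {measure set (mx_borel (n + n + 2 * r) (n + n)) -> \bar R}).
Context (nu : {measure set (herm_borel (n + n)) -> \bar R}).

Definition At (t : nat) : 'M[E]_(n + n) :=
  \matrix_(i, j) if i != j then 0 else
                 if (i < n + n - t)%N then 1 else piE^-1.

(* The set of which 1_{h,t}^{[r]} is the characteristic function; rows and
   columns are numbered from 0. *)
Definition supp (h t r : nat) : set 'M[E]_(n + n + 2 * r, n + n) :=
  [set X | mx_lattice 0 X /\
     forall (i : 'I_(n + n + 2 * r)) (j : 'I_(n + n)),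
       (n + n - t <= i < n + n)%N -> (j < n + n - h)%N ->
       OE (piE^-1 * X i j)].

Definition W (h t : nat) (B : 'M[E]_(n + n)) (r : nat) : C :=
  climit (fun k : nat =>
    cintegral nu (herm_lattice (- k%:Z)) (fun Y : hermmx conj (n + n) =>
      cintegral (mu r) setT (fun X : 'M[E]_(n + n + 2 * r, n + n) =>
        psi (herm_pairing Y
               (herm_act conj (add_unit_form (At t) r) X - B))
        * (\1_(@supp h t r) X)%:C%C))).

Definition W' (h t : nat) (B : 'M[E]_(n + n)) : C := neg_deriv_at1 (W h t B).

(* X^{\vee_h}, for 0 <= h <= 2n *)
Definition vee (h : 'I_(n + n).+1) (X : 'M[E]_(n + n)) : 'M[E]_(n + n) :=
  let e := subnK (leq_ord h) in
  let e' := subnKC (leq_ord h) in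
  let Y : 'M[E]_(n + n - h + h) := castmx (esym e, esym e) X in
  castmx (e', e')
    (block_mx (piE *: drsubmx Y) (dlsubmx Y)
              (ursubmx Y) (piE^-1 *: ulsubmx Y)).

(* The pair of (h, i) |-> beta_i^h and h |-> delta_h, for 0 <= h <= 2n and
   0 <= i <= n - 1; rev_ord h has value 2n - h. *)
Definition constants_type : choiceType :=
  ({ffun 'I_(n + n).+1 -> {ffun 'I_n -> C}} * {ffun 'I_(n + n).+1 -> C})%type.

Definition constants_spec (c : constants_type) : Prop :=
  forall (h : 'I_(n + n).+1) (B : 'M[E]_(n + n)), nondeg_herm B ->
    W' h n B - W' (rev_ord h) n (vee h B) =
    \sum_(i < n) c.1 h i * W h i B 0
    - \sum_(j < n) c.1 (rev_ord h) j * W (rev_ord h) j (vee h B) 0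
    + c.2 h * W h n B 0.

(* The constants are determined by constants_spec; xget picks them. *)
Definition constants : constants_type := xget 0 constants_spec.
Definition beta (h : 'I_(n + n).+1) (i : 'I_n) : C := constants.1 h i.

Definition J (h : 'I_(n + n).+1) (B : 'M[E]_(n + n)) : C :=
  (W n n (At n) 0)^-1 * (W' h n B - \sum_(i < n) beta h i * W h i B 0).

End Densities.

(* Main.v *)
Require Import Defs.
From mathcomp Require Import all_boot all_order all_algebra.
From mathcomp Require Import falgebra fieldext.
From mathcomp Require Import finmap complex.
From mathcomp Require Import all_classical all_reals all_analysis.
From mathcomp Require Import ring zify.

Set Implicit Arguments.
Unset Strict Implicit.
Unset Printing Implicit Defensive.

Import Order.TTheory GRing.Theory Num.Theory.
Import numFieldNormedType.Exports.

Local Open Scope classical_set_scope.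
Local Open Scope ring_scope.

(** Write O for the integers of E, w for the uniformizer, V(O) for the integral
    hermitian matrices of size 2n, S^* for the conjugate transpose of S, and
    A[X] = X^* A X.

    Fourier inversion. The double integral up to level k in W_{h,t}(B,r) only
    involves finitely many cosets. Summing the character over w^-k V(O) first
    kills every X with A[X] - B outside w^k V(O), because the trace form is
    perfect on integral hermitian matrices; what remains is the volume of
    w^-k V(O) times the volume of the X in the support of 1_{h,t} with A[X]
    congruent to B modulo w^k ([cintegral_congruence]).

    The terms with i < n vanish. The lower right block of B is 1/w, and only the
    i rows of X of weight 1/w produce denominators; so w A[X] = w B would make a
    Gram matrix of n vectors in dimension i congruent to 1 modulo w, hence
    invertible ([W_vanish]). So the sum over i is zero, and the left-hand side is
    W'_{n,n}(B,0) / W_{n,n}(A_n,0).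

    The term with i = n. Write X in blocks: V and Y are the last n columns in the
    rows of weight 1 and 1/w, and Z and w Q are the first n columns there. The
    equation A[X] = B becomes
      Y^* Y = 1 - w V^* V,   Y^* Q = - V^* Z,   Z^* Z + w Q^* Q = B1.
    A hermitian matrix congruent to 1 modulo w is g^* g with g invertible over O
    ([gram_lift]; this uses that 2 is a unit). So the number of Y is the same for
    all V, the second equation determines Q, and the third becomes a
    representation of B1 by a form congruent to 1 modulo w, which is equivalent
    to the form 1 of size n + 2r ([count_split_reps]). The number of unitary Y
    modulo w^(k+1) grows with k by the factor q^(n^2) ([count_unitary]). Hence
    W_{n,n}(B,r) = c alpha(1_{n+2r}, B1) with c nonzero and independent of r and
    of B1, and B1 = 1_n gives W_{n,n}(A_n,0) = c alpha(1_n, 1_n). The factor c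
    cancels in the quotient.

    All counting takes place in a discrete valuation ring with an involution
    ([unramified_quadratic]), which is where the arithmetic of the fields enters:
    as Q_p, F and E have a common uniformizer, the uniformizer is p up to a unit,
    which makes the integral closures discrete valuation rings. *)

(** * Counting cosets *)

Section Transversals.
Implicit Types G H : zmodType.

Definition subgroup G (L : set G) := L 0 /\ forall x y, L x -> L y -> L (x - y).

Definition transversal G (L S : set G) (I : Type) (e : I -> G) :=
  [/\ forall i, S (e i),
      forall i j, L (e i - e j) -> i = j &
      forall x, S x -> exists i, L (x - e i)].

(** Finiteness and the number of cosets in one statement: an explicit system of
    representatives is what sums and integrals are evaluated on. *)
Definition count_mod G (L S : set G) (c : nat) :=
  exists e : 'I_c -> G, transversal L S e.

Definition invariant_mod G (L S : set G) :=
  forall x y, S x -> L (y - x) -> S y.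

Lemma subgroup0 G (L : set G) : subgroup L -> L 0. Proof. by case. Qed.

Lemma subgroupB G (L : set G) x y : subgroup L -> L x -> L y -> L (x - y).
Proof. by case=> _; apply. Qed.

Lemma subgroupN G (L : set G) x : subgroup L -> L x -> L (- x).
Proof. by move=> sL Lx; rewrite -sub0r; apply: subgroupB => //; case: sL. Qed.

Lemma subgroupD G (L : set G) x y : subgroup L -> L x -> L y -> L (x + y).
Proof. by move=> sL Lx Ly; rewrite -[y]opprK; apply: subgroupB => //; apply: subgroupN. Qed.

Lemma subgroup_sym G (L : set G) x y : subgroup L -> L (x - y) -> L (y - x).
Proof. by move=> sL /(subgroupN sL); rewrite opprB. Qed.

Lemma subgroup_trans G (L : set G) y x z :
  subgroup L -> L (x - y) -> L (y - z) -> L (x - z).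
Proof. by move=> sL xy yz; rewrite -(subrKA y); apply: subgroupD. Qed.

Lemma transversal_count G (L S : set G) (I : finType) (e : I -> G) :
  transversal L S e -> count_mod L S #|I|.
Proof.
move=> [Se inj sur]; exists (fun i => e (enum_val i)); split => //.
- by move=> i j /inj /enum_val_inj.
- by move=> x /sur[i Li]; exists (enum_rank i); rewrite enum_rankK.
Qed.

(** Two transversals of the same set are matched by a bijection of their index
    sets, along which a function constant on cosets does not change. *)
Lemma sum_transversal G (L S : set G) (I J : finType) (e : I -> G) (d : J -> G)
    (M : nmodType) (f : G -> M) :
  subgroup L -> transversal L S e -> transversal L S d ->
  (forall x y, S x -> S y -> L (x - y) -> f x = f y) ->
  \sum_i f (e i) = \sum_j f (d j).
Proof.
move=> sL [Se eI eS] [Sd dI dS] fL.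
pose s i := projT1 (cid (dS _ (Se i))).
have sP i : L (e i - d (s i)) by rewrite /s; case: cid.
pose t j := projT1 (cid (eS _ (Sd j))).
have tP j : L (d j - e (t j)) by rewrite /t; case: cid.
have bs : bijective s.
  exists t => [i|j].
    by apply/esym/eI; apply: (subgroup_trans sL) (sP i) (tP _).
  by apply/esym/dI; apply: (subgroup_trans sL) (tP j) (sP _).
rewrite (reindex s); last exact: onW_bij.
by apply: eq_bigr => i _; apply: fL.
Qed.

Lemma count_mod_unique G (L S : set G) c c' :
  subgroup L -> count_mod L S c -> count_mod L S c' -> c = c'.
Proof.
move=> sL [e eP] [d dP].
have := sum_transversal sL eP dP (fun x y _ _ _ => erefl 1%N).
by rewrite !sum1_card !card_ord.
Qed.

Lemma count_mod_sub G (L S S' : set G) c : subgroup L -> S' `<=` S ->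
  invariant_mod L S' -> count_mod L S c -> exists c', count_mod L S' c'.
Proof.
move=> sL sub inv [e [Se eI eS]].
pose I : finType := {i | `[< S' (e i) >]}.
exists #|I|; apply: (@transversal_count _ _ _ I (fun i => e (val i))); split.
- by case=> i /= /asboolP.
- by move=> i j /eI /val_inj.
move=> x Sx; have [i Li] := eS _ (sub _ Sx).
have Si : `[< S' (e i) >] by apply/asboolP/(inv x) => //; apply: subgroup_sym.
by exists (exist _ i Si).
Qed.

Lemma count_mod_gt0 G (L S : set G) c x : count_mod L S c -> S x -> (0 < c)%N.
Proof. by move=> [e [_ _ eS]] /eS[i _]; apply: leq_ltn_trans (ltn_ord i). Qed.

(** The map f need not be a morphism: compatibility with the two congruences is
    enough, the fibres being taken modulo the group of the target. *)
Lemma count_mod_fibers G H (f : G -> H) (L S : set G) (L' S' : set H) c c' :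
  subgroup L -> subgroup L' -> (forall x, S x -> S' (f x)) ->
  (forall x y, S x -> S y -> L (x - y) -> L' (f x - f y)) ->
  count_mod L' S' c' ->
  (forall y, S' y -> count_mod L [set x | S x /\ L' (f x - y)] c) ->
  count_mod L S (c' * c).
Proof.
move=> sL sL' fS fL [e' [Se' eI' eS']] fib.
pose e i := projT1 (cid (fib _ (Se' i))).
have eP i : transversal L [set x | S x /\ L' (f x - e' i)] (e i).
  by rewrite /e; case: cid.
rewrite -[c']card_ord -[c]card_ord -card_prod.
apply: (@transversal_count _ _ _ _ (fun ij => e ij.1 ij.2)); split.
- by case=> i j; have [/(_ j)[]] := eP i.
- case=> i j [i' j'] /= Lij.
  have [/(_ j)[Sj Lj] eI _] := eP i; have [/(_ j')[Sj' Lj'] _ _] := eP i'.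
  have ii' : i = i'.
    apply: eI'; apply: (subgroup_trans (y := f (e i j)) sL').
      exact: subgroup_sym.
    apply: (subgroup_trans (y := f (e i' j')) sL') => //.
    exact: fL.
  by subst i'; rewrite (eI _ _ Lij).
move=> x Sx; have [i Li] := eS' _ (fS _ Sx).
by have [_ _ /(_ x (conj Sx Li))[j Lj]] := eP i; exists (i, j).
Qed.

Lemma count_mod_bij G H (f : G -> H) (L S : set G) (L' S' : set H) c :
  subgroup L' -> (forall x, S x -> S' (f x)) ->
  (forall x y, S x -> S y -> L (x - y) -> L' (f x - f y)) ->
  (forall x y, S x -> S y -> L' (f x - f y) -> L (x - y)) ->
  (forall y, S' y -> exists2 x, S x & L' (y - f x)) ->
  count_mod L S c -> count_mod L' S' c.
Proof.
move=> sL' fS fL fI fO [e [Se eI eS]]; exists (f \o e); split => /=.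
- by move=> i; apply: fS.
- by move=> i j /fI Lij; apply/eI/Lij.
move=> y /fO[x Sx Lx]; have [i Li] := eS _ Sx; exists i.
by apply: subgroup_trans Lx _ => //; apply: fL.
Qed.

(** Counting in stages: the cosets of the smaller group inside one coset of the
    larger one. *)
Lemma count_mod_tower G (L L' S : set G) c c' : subgroup L -> subgroup L' ->
  L `<=` L' -> invariant_mod L' S -> count_mod L' S c' -> count_mod L L' c ->
  count_mod L S (c' * c).
Proof.
move=> sL sL' LL' inv cS cL'.
apply: (count_mod_fibers (f := id) (L' := L') (S' := S)) => //.
  by move=> x y _ _ /LL'.
move=> y Sy; apply: (count_mod_bij (f := fun z => z + y)) cL' => //.
- move=> x Lx; split; last by rewrite /= addrK.
  by apply: inv Sy _; rewrite addrK.
- by move=> x z _ _; rewrite opprD addrACA subrr addr0.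
- by move=> x z _ _; rewrite opprD addrACA subrr addr0.
move=> x [Sx Lx]; exists (x - y) => //=.
by rewrite subrK subrr; apply: subgroup0.
Qed.

Lemma card_cosets G (L S : set G) c : subgroup L -> count_mod L S c ->
  #|` fset_set [set [set x + y | y in L] | x in S] | = c.
Proof.
move=> sL [e [Se eI eS]].
have same x y : L (x - y) -> [set x + z | z in L] = [set y + z | z in L].
  move=> Lxy; apply/seteqP; split=> _ [z Lz <-].
    by exists (x - y + z); [exact: subgroupD | rewrite addrA subrKC].
  exists (z - (x - y)); first exact: subgroupB.
  by rewrite opprB addrCA subrKC addrC.
set P := (X in fset_set X).
have -> : P = (fun i : 'I_c => [set e i + y | y in L]) @` [set: 'I_c].
  apply/seteqP; split=> _ [x Sx <-]; last by exists (e x).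
  by have [i Li] := eS _ Sx; exists i => //; apply: same; apply: subgroup_sym.
apply: (@card_fset_set _ _ c).
apply: (@card_eq_trans _ _ _ _ [set: 'I_c]); last first.
  by rewrite card_eq_sym; exact: card_II.
apply: inj_card_eq.
move=> i j _ _ eij; apply: eI.
have : [set e i + y | y in L] (e i) by exists 0; [exact: subgroup0|rewrite addr0].
by rewrite eij => -[z Lz <-]; rewrite addrC addKr.
Qed.
End Transversals.

(** * Integration of locally constant functions *)

Section HaarIntegral.
Context (R : realType) (G : zmodType) (L : nat -> set G)
  (mu : {measure set (borel L) -> \bar R}).
Hypothesis haar : normalized_haar mu.
Hypothesis sL : forall k, subgroup (L k).
Hypothesis dL : forall k, L k `<=` L 0.

Lemma measurable_invariant N (S : set G) :
  invariant_mod (L N) S -> measurable (S : set (borel L)).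
Proof.
move=> inv; apply: sub_sigma_algebra => x Sx; exists N => y Ly.
by apply: inv Sx _; rewrite addrC addKr.
Qed.

Lemma coset_invariant N (x : G) : invariant_mod (L N) [set x + y | y in L N].
Proof.
move=> _ y [z Lz <-] Ly; exists (y - x); last by rewrite addrC subrK.
by rewrite -(subrK (x + z) y) -addrA (addrC _ (- x)) addKr; apply: subgroupD.
Qed.

Lemma haar_fin N : mu (L N) \is a fin_num.
Proof.
have [mu1 _] := haar.
have mL k : measurable (L k : set (borel L)).
  apply (@measurable_invariant k) => x y Lx Lyx.
  by rewrite -(subrK x y); apply: subgroupD.
rewrite ge0_fin_numE ?measure_ge0 //.
apply: (@le_lt_trans _ _ (mu (L 0))); last by rewrite mu1 ltry.
by apply: le_measure; rewrite ?inE //; apply: dL.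
Qed.

(** The domain is the disjoint union of finitely many translates of L N, all of
    the same finite measure, and the function is constant on each. *)
Lemma Rintegral_transversal N (D : set G) c (e : 'I_c -> G) (f : G -> R) :
  transversal (L N) D e -> invariant_mod (L N) D ->
  (forall x y, D x -> D y -> L N (x - y) -> f x = f y) ->
  \int[mu]_(x in (D : set (borel L))) f x = (\sum_i f (e i)) * fine (mu (L N)).
Proof.
move=> [De eI eS] inv fL.
pose C i : set (borel L) := [set e i + y | y in L N].
have mC i : measurable (C i) by exact (@measurable_invariant N _ (@coset_invariant N (e i))).
have mD : measurable (D : set (borel L)) by exact (@measurable_invariant N _ inv).
have CD i : C i `<=` D.
  by move=> _ [y Ly <-]; apply: inv (De i) _; rewrite addrC addKr.
have muC i : mu (C i) = mu (L N).
  have [_ +] := haar; apply; apply (@measurable_invariant N) => x y Lx Lyx.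
  by rewrite -(subrK x y); apply: subgroupD.
have iC i : mu.-integrable (D : set (borel L)) (fun x => (\1_(C i) x)%:E).
  apply/integrableP; split.
    by apply/measurable_realfun.measurable_EFinP;
       exact: measurable_realfun.measurable_indic.
  under eq_integral => x _ do rewrite gee0_abs ?lee_fin ?indicE ?ler0n // -indicE.
  by rewrite integral_indic // setIidl // muC -ge0_fin_numE ?measure_ge0 // haar_fin.
have fE (x : borel L) : D x ->
    (f x)%:E = (\sum_(i < c) (f (e i))%:E * (\1_(C i) x)%:E)%E.
  move=> Dx; have [i Li] := eS _ Dx.
  rewrite (bigD1 i) //= big1 ?adde0 => [|j ji].
    rewrite indicE mem_set ?mule1 ?(fL x (e i)) //.
    by exists (x - e i); rewrite // addrC subrK.
  rewrite indicE memNset ?mule0 // => -[y Ly yx]; case/eqP: ji; apply: eI.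
  apply: subgroup_trans (sL N) _ Li; rewrite -yx -opprB addrC addKr.
  exact: subgroupN.
rewrite /Rintegral; under eq_integral => x /set_mem Dx do rewrite fE //.
rewrite integral_sum //; last by move=> i; exact: integrableZl.
under eq_bigr => i _ do rewrite integralZl // integral_indic // setIidl // muC -(fineK (haar_fin N)) -EFinM.
by rewrite sumEFin /= -mulr_suml.
Qed.

Lemma haar_lattice N c : count_mod (L N) (L 0) c -> fine (mu (L N)) = c%:R^-1.
Proof.
move=> [e eP]; have [mu1 _] := haar.
have inv : invariant_mod (L N) (L 0).
  by move=> x y Lx /dL Lyx; rewrite -(subrK x y); apply: subgroupD.
have mL : measurable (L 0 : set (borel L)) by exact (@measurable_invariant N _ inv).
have := Rintegral_transversal (f := fun=> 1) eP inv (fun x y _ _ _ => erefl).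
rewrite /Rintegral integral_cst // mul1e mu1 /= sumr_const card_ord => c1.
have c0 : (c%:R : R) != 0 by apply/eqP => c0; move: c1; rewrite c0 mul0r => /eqP; rewrite oner_eq0.
by apply: (mulfI c0); rewrite -c1 divff.
Qed.

Lemma cintegral_transversal N (D : set G) c (e : 'I_c -> G) (f : G -> R[i]) :
  transversal (L N) D e -> invariant_mod (L N) D ->
  (forall x y, D x -> D y -> L N (x - y) -> f x = f y) ->
  cintegral mu (D : set (borel L)) f =
  (\sum_i f (e i)) * ((fine (mu (L N)))%:C)%C.
Proof.
move=> eP inv fL; rewrite /cintegral.
rewrite !(Rintegral_transversal eP inv); first last.
- by move=> x y Dx Dy Lxy; rewrite (fL x y).
- by move=> x y Dx Dy Lxy; rewrite (fL x y).
rewrite -!raddf_sum; case: (\sum_i f (e i)) => a b.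
by apply/eqP; rewrite eq_complex /= !mulr0 subr0 add0r !eqxx.
Qed.
End HaarIntegral.

(** * The p-adic integers *)

Section PadicIntegers.
Context (p : nat) (hp : prime p).
Local Notation Zp := (padic_int hp).
Implicit Types a b c : Zp.

Lemma modz_dvdm (d m n : int) :
  (d %| m)%Z -> ((n %% m)%Z %% d)%Z = (n %% d)%Z.
Proof.
by move=> /divzK dm; rewrite [in RHS](divz_eq n m) -[X in _ * X + _]dm mulrA modzMDl.
Qed.

Lemma padic_of_nat n : padic_of_int hp n%:Z = n%:R.
Proof.
elim: n => [|n IHn]; first exact: padic_eqP.
rewrite -addn1 natrD -IHn; apply: padic_eqP => k /=.
by rewrite modzDm PoszD.
Qed.

Lemma padic_res1 c k : (padic_res c k.+1 %% p%:Z)%Z = padic_res c 1.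
Proof.
elim: k => [|k IHk]; first by rewrite -[RHS]padic_res_mod expn1.
rewrite -IHk [in RHS]padic_resP modz_dvdm //.
by rewrite dvdzE /= dvdn_exp.
Qed.

(** The inverses modulo p^k given by Bezout are compatible because inverses are
    unique. *)
Lemma padic_unit_res c : padic_res c 1 != 0 -> exists b, b * c = 1.
Proof.
move=> c1.
have cop k : coprimez (padic_res c k) (p ^ k)%:Z.
  rewrite coprimezE /=; case: k => [|k]; first by rewrite expn0 coprimen1.
  rewrite coprime_sym coprimeXl // prime_coprime //.
  apply: contra c1 => pd; rewrite -(padic_res1 c k); apply/eqP/dvdz_mod0P.
  by rewrite dvdzE.
pose iv k := (egcdz (padic_res c k) (p ^ k)%:Z).1.
have ivP k : (iv k * padic_res c k = 1 %[mod (p ^ k)%:Z])%Z.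
  rewrite /iv; case: egcdzP => u v uv _ /=; have /eqP <- := cop k; rewrite -uv.
  by rewrite [X in _ = (X %% _)%Z]addrC modzMDl.
have ivP' k : (iv k %% (p ^ k)%:Z)%Z =
    ((iv k.+1 %% (p ^ k.+1)%:Z)%Z %% (p ^ k)%:Z)%Z.
  rewrite modz_dvdm; last by rewrite dvdzE /= dvdn_exp2l.
  have e1 : (iv k.+1 * padic_res c k = 1 %[mod (p ^ k)%:Z])%Z.
    rewrite padic_resP modzMmr.
    have /(congr1 (fun x => (x %% (p ^ k)%:Z)%Z)) := ivP k.+1.
    by rewrite !modz_dvdm // dvdzE /= dvdn_exp2l.
  rewrite -[iv k]mul1r -modzMml -e1 modzMml -mulrA [padic_res c k * _]mulrC.
  by rewrite -modzMmr ivP modzMmr mulr1.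
exists (PadicInt hp ivP'); apply: padic_eqP => k /=.
by rewrite modzMml ivP.
Qed.

Lemma padic_div_res c : padic_res c 1 = 0 -> exists b, c = p%:R * b.
Proof.
move=> c1; have p0 : (0 < p)%N := prime_gt0 hp.
have pz : p%:Z != 0 by rewrite eqz_nat -lt0n.
have pd k : (p%:Z %| padic_res c k.+1)%Z by apply/dvdz_mod0P; rewrite padic_res1.
have bP k : (padic_res c k.+1 %/ p%:Z)%Z =
    ((padic_res c k.+2 %/ p%:Z)%Z %% (p ^ k)%:Z)%Z.
  have p0' : 0 < p%:Z by rewrite ltz_nat.
  apply: (mulIf pz); rewrite mulz_modl // !divzK // padic_resP.
  by rewrite expnS PoszM mulrC.
exists (PadicInt hp bP); rewrite -padic_of_nat; apply: padic_eqP => k /=.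
by rewrite modzMml mulrC divzK // -padic_resP.
Qed.

(** Z_p is a discrete valuation ring with uniformizer p. *)
Lemma padic_valuation c : c != 0 ->
  exists m a b, [/\ c = p%:R ^+ m * a & b * a = 1].
Proof.
move=> c0; have [k ck] : exists k, padic_res c k != 0.
  apply: contrapT => nc; case/eqP: c0; apply: padic_eqP => k /=; rewrite mod0z.
  by apply: contrapT => /eqP ck; apply: nc; exists k.
elim: k c {c0} ck => [|k IHk] c ck.
  by case/eqP: ck; rewrite padic_resP expn0 modz1.
have [c1|] := eqVneq (padic_res c 1) 0; last first.
  by case/padic_unit_res=> b bc; exists 0%N, c, b; rewrite mul1r.
have [c' cE] := padic_div_res c1.
have [|m [a [b [c'E ba]]]] := IHk c'; last first.
  by exists m.+1, a, b; split=> //; rewrite cE c'E exprS mulrA.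
apply: contra ck => /eqP c'k; rewrite cE -padic_of_nat /=; apply/eqP.
rewrite modzMml [padic_res c' k.+1](divz_eq _ (p ^ k)%:Z).
rewrite -padic_resP c'k addr0 expnS PoszM mulrCA; exact: modzMl.
Qed.

Lemma padic_natp_nonunit a : p%:R * a != 1 :> Zp.
Proof.
apply/eqP => /(congr1 (fun c => padic_res c 1)).
rewrite -padic_of_nat /= expn1 modzMml mulrC modzMl.
by rewrite modz_small // ltz_nat prime_gt1.
Qed.

(** Clearing denominators in 1/p^n + a_(n-1) / p^(n-1) + ... + a_0 = 0 gives
    1 = p b with b in Z_p. *)
Lemma padic_invp_not_integral (K : fieldType) (f : {rmorphism Zp -> K}) :
  injective f -> ~ integralOver f (f p%:R)^-1.
Proof.
move=> fI [P Pm]; rewrite /root horner_coef size_map_inj_poly ?rmorph0 //.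
have sP : size P = (size P).-1.+1 by rewrite prednK // size_poly_gt0 monic_neq0.
set n := (size P).-1 in sP; rewrite sP big_ord_recr /= coef_map.
have -> : P`_n = 1 by have /monicP := Pm; rewrite /lead_coef.
have p0 : f p%:R != 0.
  rewrite -(rmorph0 f) (inj_eq fI); apply/eqP.
  move=> /(congr1 (fun c => padic_res c 2)); rewrite -padic_of_nat /= mod0z.
  rewrite modz_small ?ltz_nat ?ltn_exp2l ?prime_gt1 // => [[/eqP]|].
    by rewrite -leqn0 leqNgt prime_gt0.
  by rewrite -[X in (X < _)%N]expn1 ltn_exp2l // prime_gt1.
rewrite /= rmorph1 mul1r => /eqP /(congr1 (fun x => f p%:R ^+ n * x)).
rewrite mulr0 mulrDr exprVn divff ?expf_neq0 // => /eqP.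
rewrite addr_eq0 mulr_sumr => /eqP S1.
pose a := - \sum_(i < n) P`_i * p%:R ^+ (n - i).-1.
case/eqP: (padic_natp_nonunit a); apply: fI.
rewrite rmorph1 rmorphM rmorphN rmorph_sum mulrN mulr_sumr -[RHS]opprK -S1.
congr (- _); apply: eq_bigr => i _; rewrite rmorphM rmorphXn coef_map /=.
rewrite exprVn mulrCA [in RHS]mulrCA; congr (_ * _).
rewrite -exprS prednK ?subn_gt0 // expfB_cond ?(negPf p0) ?add0n //; exact: ltnW.
Qed.
End PadicIntegers.

(** * Integral elements in towers of fields *)

Lemma fraction_denominator (R : idomainType) (x : {fraction R}) :
  exists2 d : R, d != 0 & exists a, tofrac d * x = tofrac a.
Proof.
elim/quotW: x => x; exists (frac x).2; first exact: denom_ratioP.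
exists (frac x).1; apply/eqP; rewrite -[_ * _]/(FracField.mul _ _) !piE.
rewrite /FracField.equivf /FracField.mulf.
by rewrite !numden_Ratio ?oner_eq0 ?mul1r ?mulr1 ?denom_ratioP // mulrC.
Qed.

Lemma tofrac_inj (R : idomainType) : injective (@tofrac R).
Proof. by move=> a b /eqP; rewrite tofrac_eq => /eqP. Qed.

Lemma common_denominator (R : idomainType) (s : seq {fraction R}) :
  exists2 d : R, d != 0 & forall i, exists a, tofrac d * s`_i = tofrac a.
Proof.
elim: s => [|x s [d d0 ds]].
  by exists 1; rewrite ?oner_neq0 // => i; exists 0; rewrite nth_nil mulr0 tofrac0.
have [d' d'0 [a' d'x]] := fraction_denominator x.
exists (d * d'); first by rewrite mulf_neq0.
move=> [|i] /=; rewrite tofracM.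
  by exists (d * a'); rewrite tofracM -d'x mulrA.
by have [a da] := ds i; exists (d' * a); rewrite tofracM -da mulrA [tofrac d * _]mulrC.
Qed.

(** If d is a common denominator of the coefficients of a monic polynomial of
    degree n that kills x, then the i-th coefficient of a polynomial killing d x
    is multiplied by d^(n - i), which has a factor d to spare for i < n. *)
Lemma integral_denominator (R : nzRingType) (Q K : fieldType)
    (z : {rmorphism R -> Q}) (f : {rmorphism Q -> K}) (x : K) :
  (forall s : seq Q, exists2 d, d != 0 & forall i, exists b, z d * s`_i = z b) ->
  integralOver f x ->
  exists2 d : R, d != 0 & integralOver (f \o z) (f (z d) * x).
Proof.
move=> den [P Pm]; have [d d0 dP] := den P.
pose a i := projT1 (cid (dP i)).
have aP i : z d * P`_i = z (a i) by rewrite /a; case: cid.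
have sP : size P = (size P).-1.+1 by rewrite prednK // size_poly_gt0 monic_neq0.
rewrite /root horner_coef size_map_poly.
set n := (size P).-1 in sP; rewrite sP big_ord_recr /= coef_map.
have -> : P`_n = 1 by have /monicP := Pm; rewrite /lead_coef.
rewrite /= rmorph1 mul1r => /eqP Px.
exists d => //; exists ('X^n + \poly_(i < n) (a i * d ^+ (n - i).-1)).
  rewrite monicE lead_coefDl ?lead_coefXn //.
  by rewrite size_polyXn ltnS size_poly.
rewrite /root rmorphD /= map_polyXn hornerD hornerXn.
set P' := \poly_(i < n) _.
rewrite (@horner_coef_wide _ n); last first.
  by apply: leq_trans (size_poly _ _) (size_poly _ _).
apply/eqP; rewrite -[RHS](mulr0 (f (z d) ^+ n)) -[in RHS]Px mulrDr addrC exprMn.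
congr (_ + _); rewrite mulr_sumr; apply: eq_bigr => i _.
rewrite !coef_map /= coef_poly ltn_ord /= rmorphM rmorphXn -aP.
rewrite !rmorphM rmorphXn exprMn -!mulrA [in RHS]mulrCA [LHS]mulrCA.
congr (_ * _); rewrite !mulrA -exprS -exprD prednK ?subn_gt0 //.
by rewrite subnK // ltnW.
Qed.

Lemma in_alg_comp (R : nzRingType) (K : fieldType) (L : fieldExtType K)
    (f : {rmorphism R -> K}) :
  exists g : {rmorphism R -> L}, forall a, g a = (f a)%:A.
Proof. by exists (in_alg L \o f : {rmorphism R -> L}). Qed.

Lemma integral_eqfun (R K : nzRingType) (f g : R -> K) x : f =1 g ->
  integralOver f x -> integralOver g x.
Proof. by move=> /funext ->. Qed.

Lemma integral_in_alg (R : nzRingType) (K : fieldType) (L : fieldExtType K)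
    (f : {rmorphism R -> K}) (g : {rmorphism R -> L}) a :
  (forall a, g a = (f a)%:A) -> integralOver g a%:A <-> integralOver f a.
Proof.
move=> gf; have gE P : root (map_poly g P) a%:A = root (map_poly f P) a.
  have -> : map_poly g P = map_poly (in_alg L) (map_poly f P).
    by rewrite -map_poly_comp; apply: eq_map_poly => b; rewrite gf.
  by rewrite /root -[a%:A]/(in_alg L a) horner_map fmorph_eq0.
split=> -[P Pm Pa]; exists P => //; first exact: (etrans (esym (gE P)) Pa).
exact: (etrans (gE P) Pa).
Qed.

Lemma field_ext_integral (K : fieldType) (L : fieldExtType K) (y : L) :
  integralOver (in_alg L) y.
Proof.
have /polyOver1P[P PE] := minPolyOver 1 y.
exists P; last by rewrite -PE root_minPoly.
by have := monic_minPoly 1 y; rewrite PE map_monic.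
Qed.

(** The coefficients of a minimal polynomial over L are themselves integral over
    K. *)
Lemma tower_integral (K : fieldType) (L : fieldExtType K) (M : fieldExtType L)
    (g : {rmorphism K -> M}) (x : M) :
  (forall a, g a = (in_alg L a)%:A) -> integralOver g x.
Proof.
move=> gE; have /polyOver1P[P PE] := minPolyOver 1 x.
apply: (@integral_root_monic _ _ _ x (minPoly 1 x)).
- exact: monic_minPoly.
- exact: root_minPoly.
rewrite PE => _ /(nthP 0)[i _ <-]; rewrite coef_map.
by apply/(integral_in_alg (f := in_alg L)) => //; apply: field_ext_integral.
Qed.

Section IntegralsOverZp.
Context (p : nat) (hp : prime p).
Context (K : fieldType) (z : {rmorphism padic_int hp -> K}).
Hypothesis zI : injective z.
Local Notation O := [set x | integralOver z x].

Lemma zp_neq0 : z p%:R != 0.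
Proof.
apply/eqP => zp; apply: (padic_invp_not_integral zI).
by rewrite zp invr0; exact: (mxpoly.integral0 z).
Qed.

Lemma integralX x n : O x -> O (x ^+ n).
Proof.
move=> Ox; elim: n => [|n IHn]; first exact: (integral1 z).
by rewrite exprS; exact: (@integral_mul _ _ z).
Qed.

(** A nonzero integral y has a multiple y t = d in Z_p, which is w^s times a
    unit; as long as y is not a unit it can be divided by w, and this happens at
    most s times. *)
Lemma uniformizer_valuation (w e : K) :
  O w -> O e -> O e^-1 -> z p%:R = w * e -> ~ O w^-1 ->
  (forall x, O x -> ~ O x^-1 -> O (w^-1 * x)) ->
  (forall x, exists2 d, d != 0 & O (z d * x)) ->
  forall x, x != 0 -> exists k : int, O (w ^ k * x) /\ O (w ^ k * x)^-1.
Proof.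
move=> Ow Oe OeV pE wV loc den.
have w0 : w != 0 by apply: contra_not_neq wV => ->; rewrite invr0; exact: (mxpoly.integral0 z).
have e0 : e != 0.
  by apply: contra_eq_neq pE => ->; rewrite mulr0 zp_neq0.
have zval d : d != 0 -> exists s f, [/\ z d = w ^+ s * f, O f, O f^-1 & f != 0].
  move=> d0; have [s [a [b [dE ba]]]] := padic_valuation d0.
  have zba : z b * z a = 1 by rewrite -rmorphM ba rmorph1.
  have za0 : z a != 0 by apply: contra_eq_neq zba => ->; rewrite mulr0 eq_sym oner_neq0.
  exists s, (e ^+ s * z a); split.
  - by rewrite dE rmorphM rmorphXn pE exprMn mulrA.
  - apply: (@integral_mul _ _ z); [exact: integralX | exact: integral_id].
  - rewrite invfM -exprVn; apply: (@integral_mul _ _ z); first exact: integralX.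
    by rewrite -[(z a)^-1]mul1r -zba mulfK //; exact: integral_id.
  - by rewrite mulf_neq0 // expf_neq0.
have val s : forall y t f, O y -> O t -> O f^-1 -> f != 0 -> y * t = w ^+ s * f ->
    exists k, O (w ^- k * y) /\ O (w ^- k * y)^-1.
  elim: s => [|s IHs] y t f Oy Ot Of f0 yt.
    exists 0%N; rewrite expr0 invr1 mul1r; split => //.
    have y0 : y != 0 by apply: contra_eq_neq yt => ->; rewrite mul0r mul1r eq_sym.
    have -> : y^-1 = t * f^-1.
      by apply: (mulfI y0); rewrite divff // mulrA yt mul1r divff.
    exact: (@integral_mul _ _ z).
  case: (pselect (O y^-1)) => [OV|NV].
    by exists 0%N; rewrite expr0 invr1 mul1r.
  have [|k [Ok OkV]] := IHs (w^-1 * y) t f (loc _ Oy NV) Ot Of f0.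
    by rewrite -mulrA yt exprS mulrA mulKf.
  exists k.+1; suff -> : w ^- k.+1 * y = w ^- k * (w^-1 * y) by [].
  by rewrite exprSr invfM mulrA.
move=> x x0; have [d d0 Od] := den x; have [d' d'0 Od'] := den (z d * x)^-1.
have zd0 : z d != 0 by rewrite -(rmorph0 z) (inj_eq zI).
have [s [f [d'E _ Of f0]]] := zval _ d'0.
have [s' [f' [dE Of' OfV' f'0]]] := zval _ d0.
have [|k [Ok OkV]] := val s _ _ f Od Od' Of f0.
  by rewrite mulrCA divff ?mulr1 // mulf_neq0.
exists (s'%:Z - k%:Z); rewrite expfzDr // -exprnN -exprnP.
have -> : w ^+ s' * w ^- k * x = w ^- k * (z d * x) * f'^-1.
  by rewrite dE; apply: (mulIf f'0); rewrite divfK //; ring.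
split; first exact: (@integral_mul _ _ z).
by rewrite invfM invrK; exact: (@integral_mul _ _ z).
Qed.

(** Z_p is integrally closed with maximal ideal p Z_p: a uniformizer of the
    integers of Q_p is p up to a unit. *)
Lemma fraction_uniformizer (a : K) :
  (forall y, exists2 d, d != 0 & exists b, z d * y = z b) ->
  uniformizer O a -> exists y, [/\ O y, O y^-1 & z p%:R = a * y].
Proof.
move=> frac ua; have p0 := zp_neq0.
have [y Oy pE] : [set a * y | y in O] (z p%:R).
  rewrite -ua; split; first exact: (integral_id z).
  move=> [y Oy py]; apply: (padic_invp_not_integral zI).
  by have -> : (z p%:R)^-1 = y by apply: (mulfI p0); rewrite divff.
exists y; split => //.
have [Oa aV] : maximal_ideal (O) a.
  by rewrite ua; exists 1; rewrite ?mulr1 //; exact: (integral1 z).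
have a0 : a != 0 by apply: contra_eq_neq pE => ->; rewrite mul0r eq_sym.
have y0 : y != 0 by apply: contra_eq_neq pE => ->; rewrite mulr0 eq_sym.
have [d d0 [b db]] := frac y.
have b0 : b != 0.
  by rewrite -(inj_eq zI) rmorph0 -db mulf_neq0 // -(rmorph0 z) (inj_eq zI).
have [m [c [c' [dE cc]]]] := padic_valuation d0.
have [m' [f [f' [bE ff]]]] := padic_valuation b0.
have zcc : z c' * z c = 1 by rewrite -rmorphM cc rmorph1.
have zff : z f' * z f = 1 by rewrite -rmorphM ff rmorph1.
have zc0 : z c != 0 by apply: contra_eq_neq zcc => ->; rewrite mulr0 eq_sym oner_neq0.
have zf0 : z f != 0 by apply: contra_eq_neq zff => ->; rewrite mulr0 eq_sym oner_neq0.
have {db} yE : z p%:R ^+ m * z c * y = z p%:R ^+ m' * z f.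
  by have := db; rewrite dE bE !rmorphM !rmorphXn.
have OM x x' : O x -> O x' -> O (x * x').
  exact: (@integral_mul _ _ z).
have Oz x : O (z x) by exact: (integral_id z).
have OX x n : O x -> O (x ^+ n) by exact: integralX.
have Pc0 : z p%:R ^+ m * z c != 0 by rewrite mulf_neq0 ?expf_neq0.
have Pf0 : z p%:R ^+ m' * z f != 0 by rewrite mulf_neq0 ?expf_neq0.
have [mm'|m'm|mm'] := ltngtP m m'.
- case: aV; exists (y * z p%:R ^- 1); last first.
    by rewrite mulrA pE expr1 divff.
  have -> : y * z p%:R ^- 1 = z p%:R ^+ (m' - m).-1 * z f * z c'.
    apply: (mulIf p0); rewrite divfK //; apply: (mulfI Pc0).
    rewrite yE -{1}(subnKC (ltnW mm')) exprD -{1}(prednK (_ : 0 < m' - m)%N) ?subn_gt0 //.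
    by rewrite exprS -[LHS]mulr1 -zcc; ring.
  by apply: (OM); rewrite //; apply: OM => //; apply: OX.
- case: (padic_invp_not_integral zI).
  have -> : (z p%:R)^-1 = y * z p%:R ^+ (m - m').-1 * z c * z f'.
    apply: (mulfI p0); rewrite divff //; apply: (mulfI Pf0).
    rewrite mulr1 -{1}yE -{1}(subnKC (ltnW m'm)) exprD -{1}(prednK (_ : 0 < m - m')%N) ?subn_gt0 //.
    by rewrite exprS -[LHS]mulr1 -zff; ring.
  by apply: (OM); rewrite //; apply: (OM); rewrite //; apply: OM => //; apply: OX.
- have -> : y^-1 = z c * z f'.
    apply: (mulfI y0); rewrite divff //; apply: (mulfI Pf0).
    by rewrite mulr1 -{1}yE -mm' -[LHS]mulr1 -zff; ring.
  exact: OM.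
Qed.
End IntegralsOverZp.

(** * The ring of integers of the quadratic extension *)

(** The interface between the arithmetic of p-adic fields and the counting: K
    stands for E, O for its integers, w for the uniformizer, and the elements
    fixed by conj for the base field, whose residue field has q elements. Odd
    residue characteristic enters through [uq_half] and [uq_skew], which split an
    element of O into a fixed part and a skew part. *)
Record unramified_quadratic (K : fieldType) (conj : {rmorphism K -> K})
    (O : set K) (w : K) (q : nat) : Prop := UnramifiedQuadratic {
  uq_1 : O 1;
  uq_B : forall x y, O x -> O y -> O (x - y);
  uq_M : forall x y, O x -> O y -> O (x * y);
  uq_conj : forall x, O x -> O (conj x);
  uq_conjK : involutive conj;
  uq_conjw : conj w = w;
  uq_w : O w;
  uq_w0 : w != 0;
  uq_wV : ~ O w^-1;
  uq_val : forall x, x != 0 -> exists k : int, O (w ^ k * x) /\ O (w ^ k * x)^-1;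
  uq_two : (2 : K) != 0;
  uq_half : O 2^-1;
  uq_skew : exists u, [/\ conj u = - u, u != 0, O u & O u^-1];
  uq_residue : count_mod [set x | O (w^-1 * x)] [set x | O x /\ conj x = x] q }.

Lemma uniformizer_assoc (K : fieldType) (O : set K) a b :
  O 1 -> uniformizer O a -> uniformizer O b -> exists2 t, O t & b = a * t.
Proof.
move=> O1 ua ub; have : maximal_ideal O b by rewrite ub; exists 1; rewrite ?mulr1.
by rewrite ua => -[t Ot <-]; exists t.
Qed.

Section QuadraticConjugation.
Context (F : fieldType) (E : fieldExtType F) (quadE : \dim {:E} = 2%N)
  (conj : {rmorphism E -> E}) (conj_F : forall a : F, conj a%:A = a%:A)
  (conj_nontriv : exists x : E, conj x != x).

Lemma conj_scale (a : F) x : conj (a *: x) = a *: conj x.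
Proof. by rewrite -[a *: x]mulr_algl rmorphM conj_F mulr_algl. Qed.

Lemma conj_generator : exists2 w : E, conj w != w &
  forall y, exists a b : F, y = a%:A + b *: w.
Proof.
have [w wN] := conj_nontriv; exists w => // y.
have w1 : w \notin 1%VS.
  by apply: contra wN => /vlineP[a ->]; rewrite conj_F.
have fr : free [:: w; 1%R].
  by rewrite free_cons span_seq1 w1 seq1_free oner_neq0.
have : y \in <<[:: w; 1%R]>>%VS.
  suff -> : <<[:: w; 1%R]>>%VS = {:E}%VS by rewrite memvf.
  apply/eqP; rewrite eqEdim subvf quadE.
  by have /eqP -> := fr.
rewrite span_cons span_seq1 => /memv_addP[_ /vlineP[b ->] [_ /vlineP[a ->] ->]].
by exists a, b; rewrite addrC.
Qed.

(** A generator w and its conjugate are the two roots of the quadratic equation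
    of w, so conjugation exchanges them. *)
Lemma conj_involutive : involutive conj.
Proof.
have [w wN gen] := conj_generator; pose v := conj w.
have [a [b w2]] := gen (w ^+ 2).
have v2 : v ^+ 2 = a%:A + b *: v.
  by rewrite -rmorphXn w2 rmorphD conj_F conj_scale.
have wv : w + v = b%:A.
  have d0 : w - v != 0 by rewrite subr_eq0 eq_sym.
  apply: (mulIf d0); rewrite mulrC -subr_sqr w2 v2 mulr_algl scalerBr.
  by rewrite opprD addrACA subrr add0r.
have vw : conj v = w.
  by rewrite -[v](addKr w) wv addrC rmorphB conj_F -wv addrK.
move=> x; have [c [d ->]] := gen x.
by rewrite !(rmorphD, conj_F, conj_scale) vw.
Qed.

Lemma conj_fixed x : conj x = x -> exists a : F, x = a%:A.
Proof.
have [w wN gen] := conj_generator; have [a [b ->]] := gen x.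
rewrite rmorphD conj_F conj_scale => /addrI/eqP; rewrite -subr_eq0 -scalerBr.
rewrite scaler_eq0 subr_eq0 (negPf wN) orbF => /eqP ->.
by exists a; rewrite scale0r addr0.
Qed.

Lemma conj_skew : exists2 u, conj u = - u & u != 0.
Proof.
have [w wN] := conj_nontriv; exists (w - conj w); last by rewrite subr_eq0 eq_sym.
by rewrite rmorphB conj_involutive opprB.
Qed.
End QuadraticConjugation.

(** Q is the field of p-adic numbers, kept abstract: it is only known to be
    generated by fractions of elements of Z_p. *)
Section TowerOfIntegers.
Context (p : nat) (hp : prime p) (p_odd : odd p)
  (Q : fieldType) (zQ : {rmorphism padic_int hp -> Q}) (zQI : injective zQ)
  (zQ_frac : forall s : seq Q, exists2 d, d != 0 &
    forall i, exists b, zQ d * s`_i = zQ b)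
  (F : fieldExtType Q) (E : fieldExtType F).
Local Notation OQ := (integers zQ).
Local Notation OF := (integers (fun a => (zQ a)%:A : F)).
Local Notation OE := (integers (fun a => ((zQ a)%:A : F)%:A : E)).
Context (unramF : unramified OQ OF) (unramE : unramified OF OE)
  (quadE : \dim {:E} = 2%N) (pi : F) (unif_pi : uniformizer OF pi)
  (q : nat) (card_q : (residue_field OF #= `I_q)%card)
  (conj : {rmorphism E -> E}) (conj_F : forall a : F, conj a%:A = a%:A)
  (conj_nontriv : exists x : E, conj x != x).

Lemma tower_integers_base a : OE a%:A <-> OF a.
Proof.
have [zF zFE] := in_alg_comp F zQ.
have [zE zEE] := in_alg_comp E zF.
have iff := integral_in_alg a zEE.
split=> [Oa|Oa].
  suff /iff : integralOver zE a%:A by apply: integral_eqfun => c; rewrite zFE.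
  by apply: integral_eqfun Oa => c; rewrite zEE zFE.
suff : integralOver zE a%:A by apply: integral_eqfun => c; rewrite zEE zFE.
by apply/iff; apply: integral_eqfun Oa => c; rewrite zFE.
Qed.

Lemma integers_unramified_quadratic_gen : unramified_quadratic conj OE pi%:A q.
Proof.
have [zF zFE] := in_alg_comp F zQ.
have [zE zEE] := in_alg_comp E zF.
have FP x : OF x <-> integralOver zF x.
  by split; apply: integral_eqfun => a; rewrite zFE.
have EP x : OE x <-> integralOver zE x.
  by split; apply: integral_eqfun => a; rewrite zEE zFE.
have baseP := tower_integers_base.
have base0P a : OF a%:A <-> OQ a.
  have iff := integral_in_alg a zFE.
  by split=> [/FP /iff|/iff h] //; apply/FP.
have AI (K : fieldType) (L : fieldExtType K) (c d : K) : c%:A = d%:A :> L -> c = d.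
  exact: (fmorph_inj (in_alg L)).
have zEI : injective zE by move=> x x'; rewrite !zEE !zFE => /AI/AI/zQI.
have OE1 : OE 1 by apply/EP; exact: integral1.
have OEB x x' : OE x -> OE x' -> OE (x - x').
  by move=> /EP Ox /EP Ox'; apply/EP; exact: integral_sub.
have OEM x x' : OE x -> OE x' -> OE (x * x').
  by move=> /EP Ox /EP Ox'; apply/EP; exact: integral_mul.
have OE0 : OE 0 by rewrite -(subrr 1); apply: OEB.
have OEn n : OE n%:R by apply/EP; exact: integral_nat.
have OFM x x' : OF x -> OF x' -> OF (x * x').
  by move=> /FP Ox /FP Ox'; apply/FP; exact: integral_mul.
have OF1 : OF 1 by apply/FP; exact: integral1.
have zQ_frac1 x : exists2 d, d != 0 & exists b, zQ d * x = zQ b.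
  by have [d d0 /(_ 0%N)] := zQ_frac [:: x]; exists d.
(* a, b and pi are uniformizers of F, hence associated; p is associated to a. *)
have [a ua uaF] := unramF; have [b ub ubE] := unramE.
have [y [Oy OyV pE]] := fraction_uniformizer zQI zQ_frac1 ua.
have [t Ot piE] := uniformizer_assoc OF1 ub unif_pi.
have [t' Ot' bE] := uniformizer_assoc OF1 unif_pi ub.
have [s Os piE'] := uniformizer_assoc OF1 uaF unif_pi.
have [s' Os' aE] := uniformizer_assoc OF1 unif_pi uaF.
pose w : E := pi%:A.
have AM (K : fieldType) (L : fieldExtType K) (c d : K) : (c * d)%:A = c%:A * d%:A :> L.
  exact: (rmorphM (in_alg L)).
have uE : uniformizer OE w.
  rewrite /uniformizer ubE; apply/seteqP; split=> _ [x Ox <-].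
    exists (t'%:A * x); first by apply: OEM => //; apply/baseP.
    by rewrite mulrA -AM -bE.
  exists (t%:A * x); first by apply: OEM => //; apply/baseP.
  by rewrite mulrA -AM -piE.
pose e : E := (s' * y%:A)%:A.
have zpE : zE p%:R = w * e.
  by rewrite zEE zFE pE !AM aE /e /w !AM mulrA.
have zp0 := zp_neq0 zEI.
have w0 : w != 0 by apply: contra_eq_neq zpE => ->; rewrite mul0r.
have pi0 : pi != 0 by apply: contra_neq w0 => p0; rewrite /w p0 scale0r.
have ss : s * s' = 1.
  by apply: (mulfI pi0); rewrite mulr1 mulrA mulrAC -aE -piE'.
have Oe : OE e by apply/baseP/OFM => //; apply/base0P.
have y0 : y != 0.
  apply: contra_eq_neq pE => ->; rewrite mulr0; exact: zp_neq0.
have OeV : OE e^-1.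
  have -> : e^-1 = (s * (y^-1)%:A)%:A.
    have e0 : e != 0 by apply: contra_eq_neq zpE => ->; rewrite mulr0.
    apply: (mulfI e0); rewrite divff //.
    have -> : e * (s * (y^-1)%:A)%:A = (s * s')%:A * ((y * y^-1)%:A)%:A.
      by rewrite /e !AM; ring.
    by rewrite ss divff // !scale1r mulr1.
  by apply/baseP/OFM => //; apply/base0P.
have Ow : OE w by have [] : maximal_ideal OE w by rewrite uE; exists 1; rewrite ?mulr1.
have wV : ~ OE w^-1.
  have [_ wN] : maximal_ideal OE w by rewrite uE; exists 1; rewrite ?mulr1.
  by move=> OwV; apply: wN; exists w^-1; rewrite ?divff.
have loc x : OE x -> ~ OE x^-1 -> OE (w^-1 * x).
  move=> Ox xV; have [x0|x0] := eqVneq x 0; first by rewrite x0 mulr0.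
  have : maximal_ideal OE x.
    split=> // -[x' Ox' xx']; apply: xV; suff -> : x^-1 = x' by [].
    by apply: (mulfI x0); rewrite divff.
  by rewrite uE => -[x' Ox' <-]; rewrite mulKf.
have den x : exists2 d, d != 0 & OE (zE d * x).
  have [g gE] := in_alg_comp E (in_alg F).
  have [d d0 Od] := integral_denominator zQ_frac (tower_integral x gE).
  exists d => //; apply/EP; rewrite zEE zFE.
  have -> : ((zQ d)%:A)%:A = g (zQ d) by rewrite gE.
  by apply: integral_eqfun Od => c /=; rewrite gE zEE zFE.
have val x : x != 0 -> exists k : int, OE (w ^ k * x) /\ OE (w ^ k * x)^-1.
  move=> x0; have [||||c|c|k [Ok OkV]] := uniformizer_valuation zEI _ _ _ zpE _ _ _ x0.
  - exact/EP.
  - exact/EP.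
  - exact/EP.
  - by move/EP.
  - by move=> /EP Oc cV; apply/EP/loc => // /EP.
  - by have [d d0 /EP Od] := den c; exists d.
  by exists k; split; apply/EP.
have conjw : conj w = w by rewrite /w conj_F.
(* 2 is not divisible by w, since p = 2 (p./2) + 1 is. *)
have O2 : ~ OE (w^-1 * 2).
  move=> O2; apply: wV.
  have -> : w^-1 = e - (w^-1 * 2) * (p./2)%:R; last by apply: OEB => //; apply: OEM.
  apply: (mulfI w0); rewrite divff // mulrBr -zpE rmorph_nat !mulrA divff // mul1r.
  by rewrite -natrM mul2n -[in p%:R](odd_double_half p) p_odd natrD addrK.
split => //.
- move=> x /EP[P Pm /eqP Px]; apply/EP; exists P => //; apply/eqP.
  have -> : map_poly zE P = map_poly conj (map_poly zE P).
    by rewrite -map_poly_comp; apply: eq_map_poly => c /=; rewrite zEE conj_F.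
  by rewrite horner_map Px rmorph0.
- exact: conj_involutive.
- by apply/eqP => E2; apply: O2; rewrite E2 mulr0.
- by apply: contrapT => h; apply: O2; apply: loc.
- have [u cu u0] := conj_skew quadE conj_F conj_nontriv.
  have [k [Ok OkV]] := val u u0; exists (w ^ k * u); split=> //.
    by rewrite rmorphM fmorphXz conjw cu mulrN.
  by rewrite mulf_neq0 // expfz_neq0.
have /card_set_bijP[f [fS fI fO]] := card_esym card_q.
have cE (i : 'I_q) : exists2 c, OF c & [set c + d | d in maximal_ideal OF] = f i.
  by have [c Oc <-] := fS i (ltn_ord i); exists c.
pose c i := projT1 (cid2 (cE i)).
have [Oc cf] : (forall i, OF (c i)) /\
    forall i, [set c i + d | d in maximal_ideal OF] = f i.
  by split=> i; rewrite /c; case: cid2.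
have OF0 : OF 0 by apply/FP; exact: mxpoly.integral0.
have OFB x x' : OF x -> OF x' -> OF (x - x').
  by move=> /FP Ox /FP Ox'; apply/FP; exact: integral_sub.
have wOF x : OE (w^-1 * x%:A) <-> OF (pi^-1 * x).
  by rewrite -[w]/(in_alg E pi) -fmorphV -AM; exact: baseP.
exists (fun i => (c i)%:A); split => /=.
- by move=> i; split; [exact/baseP | exact: conj_F].
- move=> i j; rewrite -scalerBl wOF => Oij.
  apply: val_inj; apply: fI; rewrite ?inE /=; try exact: ltn_ord.
  rewrite -(cf i) -(cf j) unif_pi.
  apply/seteqP; split=> _ [_ [x Ox <-] <-].
    exists (pi * (pi^-1 * (c i - c j) + x)); last first.
      by rewrite mulrDr mulVKf // addrA subrKC.
    exists (pi^-1 * (c i - c j) + x) => //.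
    by rewrite -[x]opprK -[- x]sub0r; apply: (OFB); rewrite //; apply: OFB.
  exists (pi * (x - pi^-1 * (c i - c j))); last first.
    by rewrite mulrBr mulVKf // opprB addrCA subrKC addrC.
  by exists (x - pi^-1 * (c i - c j)) => //; apply: OFB.
move=> x [Ox /(conj_fixed quadE conj_F conj_nontriv)[d dE]].
have Od : OF d by apply/baseP; rewrite -dE.
have [|i iq fi] := fO [set d + x | x in maximal_ideal OF]; first by exists d.
exists (Ordinal iq); rewrite dE -scalerBl wOF.
have : [set d + x | x in maximal_ideal OF] d.
  by exists 0; rewrite ?addr0 // unif_pi; exists 0; rewrite ?mulr0.
rewrite -fi -(cf (Ordinal iq)) unif_pi => -[_ [x' Ox' <-] <-].
by rewrite addrC addKr mulKf.
Qed.
End TowerOfIntegers.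

Lemma integers_unramified_quadratic
  (p : nat) (hp : prime p) (p_odd : odd p)
  (F : fieldExtType (padic hp)) (E : fieldExtType F)
  (unramF : unramified (padic_integers hp) (base_integers F))
  (unramE : unramified (base_integers F) (ext_integers E))
  (quadE : \dim {:E} = 2%N)
  (pi : F) (unif_pi : uniformizer (base_integers F) pi)
  (q : nat) (card_q : (residue_field (base_integers F) #= `I_q)%card)
  (conj : {rmorphism E -> E}) (conj_F : forall a : F, conj a%:A = a%:A)
  (conj_nontriv : exists x : E, conj x != x) :
  unramified_quadratic conj (ext_integers E) pi%:A q.
Proof.
exact: (@integers_unramified_quadratic_gen p hp p_odd _ (@tofrac (padic_int hp))
  (@tofrac_inj _) (@common_denominator _)).
Qed.

Lemma ext_integers_base (p : nat) (hp : prime p) (F : fieldExtType (padic hp))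
  (E : fieldExtType F) (a : F) : ext_integers E a%:A <-> base_integers F a.
Proof. exact: (@tower_integers_base p hp _ (@tofrac (padic_int hp)) F E a). Qed.

(** * Ideals and hermitian coordinates *)

Section Lattices.
Context (K : fieldType) (conj : {rmorphism K -> K}) (O : set K) (w : K) (q : nat).
Hypothesis U : unramified_quadratic conj O w q.

Definition ideal (d : int) : set K := [set x | O (w ^ (- d) * x)].
Local Notation P := ideal.

Let w0 : w != 0 := uq_w0 U.
Let OM := uq_M U.

Lemma O0 : O 0. Proof. by rewrite -(subrr 1); apply: (uq_B U); apply: (uq_1 U). Qed.
Lemma ON x : O x -> O (- x).
Proof. by rewrite -sub0r; apply: (uq_B U); exact: O0. Qed.
Lemma OD x y : O x -> O y -> O (x + y).
Proof. by move=> Ox Oy; rewrite -[y]opprK; apply: (uq_B U) => //; exact: ON. Qed.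
Lemma OX x n : O x -> O (x ^+ n).
Proof.
by move=> Ox; elim: n => [|n IH]; rewrite ?expr0 ?exprS; [exact: (uq_1 U)|exact: OM].
Qed.

Lemma ideal_subgroup d : subgroup (P d).
Proof.
split; first by rewrite /P /= mulr0; exact: O0.
by move=> x y; rewrite /P /= mulrBr; exact: (uq_B U).
Qed.

Lemma ideal0 x : P 0 x <-> O x. Proof. by rewrite /P /= oppr0 expr0z mul1r. Qed.

Lemma idealM a b x y : P a x -> P b y -> P (a + b) (x * y).
Proof. by move=> Px Py; rewrite /P /= opprD expfzDr // mulrACA; exact: OM. Qed.

Lemma ideal_w d : P d (w ^ d).
Proof. by rewrite /P /= -expfzDr // addNr expr0z; exact: (uq_1 U). Qed.

Lemma ideal_le a b : a <= b -> P b `<=` P a.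
Proof.
move=> ab x Px; rewrite /P /=.
have -> : w ^ (- a) * x = w ^ (b - a) * (w ^ (- b) * x).
  by rewrite mulrA -expfzDr // addrAC subrr add0r.
apply: OM => //; move: ab; rewrite -subr_ge0; case: (b - a) => // n _.
by rewrite -exprnP; apply: OX; exact: (uq_w U).
Qed.

Lemma conj_w d : conj (w ^ d) = w ^ d.
Proof. by rewrite fmorphXz (uq_conjw U). Qed.

Lemma ideal_conj d x : P d x -> P d (conj x).
Proof. by move=> /(uq_conj U); rewrite rmorphM conj_w. Qed.

Lemma ideal_scale a b x : P a x <-> P (a + b) (w ^ b * x).
Proof.
by rewrite /P /= mulrA -expfzDr // opprD subrK.
Qed.

Lemma ideal_half d x : P d x -> P d (2^-1 * x).
Proof.
move=> Px; rewrite -[d]add0r; apply: idealM => //; apply/ideal0; exact: (uq_half U).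
Qed.

(** The ideals of the base field, seen inside K. *)
Definition fixed_ideal d : set K := [set x | P d x /\ conj x = x].

Lemma fixed_subgroup d : subgroup (fixed_ideal d).
Proof.
have sP := ideal_subgroup d.
split; first by split; [exact: subgroup0 | rewrite rmorph0].
by move=> x y [Px cx] [Py cy]; split; [exact: subgroupB | rewrite rmorphB cx cy].
Qed.

(** Multiplication by w^d reduces the count to that of the residue field. *)
Lemma count_fixed_step (d : int) :
  count_mod (fixed_ideal (d + 1)) (fixed_ideal d) q.
Proof.
apply: (count_mod_bij (f := fun x => w ^ d * x)) (uq_residue U).
- exact: fixed_subgroup.
- move=> x [Ox cx]; split; last by rewrite rmorphM conj_w cx.
  by rewrite -[d]add0r addrC; move/ideal0: Ox => /(ideal_scale _ d); rewrite add0r addr0.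
- move=> x y [_ cx] [_ cy] /= Oxy; split; last by rewrite rmorphB !rmorphM conj_w cx cy.
  rewrite -mulrBr [d + 1]addrC -ideal_scale /P /=.
  by rewrite exprN1.
- move=> x y _ _ [+ _]; rewrite -mulrBr [d + 1]addrC -ideal_scale /P /=.
  by rewrite exprN1.
move=> y [Py cy]; exists (w ^ (- d) * y).
  by split=> //; rewrite rmorphM conj_w cy.
by rewrite mulrA -expfzDr // subrr expr0z mul1r subrr; exact: subgroup0 (fixed_subgroup _).
Qed.

Lemma count_fixed d k : count_mod (fixed_ideal (d + k%:Z)) (fixed_ideal d) (q ^ k).
Proof.
elim: k => [|k IHk].
  rewrite addr0 expn0; have sf := fixed_subgroup d.
  exists (fun=> 0); split => [_|i j _|x fx]; first exact: subgroup0.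
    by rewrite !ord1.
  by exists ord0; rewrite subr0.
rewrite expnSr; apply: (count_mod_tower (L' := fixed_ideal (d + k%:Z))) => //.
- exact: fixed_subgroup.
- exact: fixed_subgroup.
- by move=> x [Px cx]; split=> //; apply: ideal_le Px; rewrite lerD2l lez_nat.
- move=> x y [Px cx] [Pyx cyx]; rewrite -(subrK x y).
  apply: (subgroupD (fixed_subgroup d)); split => //.
  by apply: ideal_le Pyx; rewrite lerDl.
by rewrite -addn1 PoszD addrA; exact: count_fixed_step.
Qed.

Lemma skew_unit : exists u, [/\ conj u = - u, u != 0,
  forall d x, P d x -> P d (u * x) & forall d x, P d x -> P d (u^-1 * x)].
Proof.
have [u [cu u0 Ou OuV]] := uq_skew U; exists u; split=> // d x Px; rewrite -[d]add0r;
  by apply: idealM => //; apply/ideal0.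
Qed.

Lemma skewB (u a b c d : K) : a + u * b - (c + u * d) = a - c + u * (b - d).
Proof. by ring. Qed.

Lemma residue_gt0 : (0 < q)%N.
Proof.
by apply: (count_mod_gt0 (x := 0) (uq_residue U)); split; [exact: O0|rewrite rmorph0].
Qed.

Lemma residue_gt1 : (1 < q)%N.
Proof.
have [e [_ _ eS]] := uq_residue U.
have [i0 Pi0] := eS 0 (Logic.conj O0 (rmorph0 conj)).
have [i1 Pi1] := eS 1 (Logic.conj (uq_1 U) (rmorph1 conj)).
rewrite ltnNge; apply/negP => q1; apply: (uq_wV U).
have ii : i1 = i0 by apply: val_inj; case: i0 i1 q1 {Pi0 Pi1} => [a ?] [b ?] /=; lia.
have := uq_B U Pi1 Pi0; rewrite ii -mulrBr opprB addrA subrK subr0 mulr1; exact.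
Qed.

(** Half the sum of x + u y and its conjugate is x, and half their difference is
    u y; both operations preserve the ideals. *)
Lemma skew_coord u d x y : conj u = - u -> u != 0 ->
  (forall e z, P e z -> P e (u^-1 * z)) -> conj x = x -> conj y = y ->
  P d (x + u * y) -> P d x /\ P d y.
Proof.
move=> cu u0 uV cx cy Pz; have sP := ideal_subgroup d.
have /ideal_conj := Pz; rewrite rmorphD rmorphM cx cy cu mulNr => Pz'.
have two := uq_two U; split.
  have -> : x = 2^-1 * ((x + u * y) + (x - u * y)) by field.
  by apply: ideal_half; apply: subgroupD.
have -> : y = u^-1 * (2^-1 * ((x + u * y) - (x - u * y))) by field; rewrite u0 two.
by apply: uV; apply: ideal_half; apply: subgroupB.
Qed.

Lemma skew_decomp u d z : conj u = - u -> u != 0 ->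
  (forall e z, P e z -> P e (u^-1 * z)) -> P d z ->
  exists x y, [/\ fixed_ideal d x, fixed_ideal d y & z = x + u * y].
Proof.
move=> cu u0 uV Pz; have sP := ideal_subgroup d; have Pc := ideal_conj Pz.
have two := uq_two U.
exists (2^-1 * (z + conj z)), (u^-1 * (2^-1 * (z - conj z))); split.
- split; first by apply: ideal_half; apply: subgroupD.
  by rewrite rmorphM fmorphV rmorph_nat rmorphD (uq_conjK U) [conj z + z]addrC.
- split; first by apply: uV; apply: ideal_half; apply: subgroupB.
  rewrite !rmorphM !fmorphV rmorph_nat rmorphB (uq_conjK U) cu.
  by rewrite invrN mulNr -!mulrN opprB.
by field; rewrite u0 two.
Qed.

(** * Lattices of matrices *)

(** The lattice w^d M(O), over an arbitrary valuation ring O. *)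
Definition mx_ideal m n d : set 'M[K]_(m, n) :=
  [set X | forall i j, O (w ^ (- d) * X i j)].
Local Notation ct X := (map_mx conj X^T).

Lemma mx_ideal_subgroup m n d : subgroup (@mx_ideal m n d).
Proof.
split=> [i j|X Y PX PY i j]; rewrite !mxE; have sP := ideal_subgroup d.
  exact: (subgroup0 sP).
exact: (subgroupB sP).
Qed.

Lemma mx_idealM m n k a b (X : 'M[K]_(m, n)) (Y : 'M[K]_(n, k)) :
  mx_ideal a X -> mx_ideal b Y -> mx_ideal (a + b) (X *m Y).
Proof.
move=> PX PY i j; rewrite mxE.
apply: (big_ind (P (a + b))) => [|x y|l _].
- exact: subgroup0 (ideal_subgroup _).
- exact: subgroupD (ideal_subgroup _).
- exact: (idealM (PX i l) (PY l j)).
Qed.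

Lemma mx_ideal_le m n a b : a <= b -> @mx_ideal m n b `<=` mx_ideal a.
Proof. by move=> ab X PX i j; exact: (ideal_le ab (PX i j)). Qed.

Lemma mx_ideal_conj m n d (X : 'M[K]_(m, n)) : mx_ideal d X -> mx_ideal d (ct X).
Proof. by move=> PX i j; rewrite !mxE; exact: (ideal_conj (PX j i)). Qed.

Lemma mx_ideal_scale m n a b (X : 'M[K]_(m, n)) :
  mx_ideal a X <-> mx_ideal (a + b) (w ^ b *: X).
Proof.
split=> PX i j.
  by rewrite mxE; have /(ideal_scale _ b) := PX i j.
have : P (a + b) (w ^ b * X i j) by have := PX i j; rewrite mxE.
by rewrite -ideal_scale.
Qed.

Lemma mx_ideal_half m n d (X : 'M[K]_(m, n)) :
  mx_ideal d X -> mx_ideal d (2^-1 *: X).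
Proof. by move=> PX i j; rewrite mxE; exact: (ideal_half (PX i j)). Qed.

Lemma mx_ideal_1 n : mx_ideal 0 (1%:M : 'M[K]_n).
Proof.
move=> i j; rewrite oppr0 expr0z mul1r mxE.
by case: eqP => _; [exact: (uq_1 U) | exact: O0].
Qed.

Lemma ctM m n k (X : 'M[K]_(m, n)) (Y : 'M[K]_(n, k)) : ct (X *m Y) = ct Y *m ct X.
Proof. by rewrite trmx_mul map_mxM. Qed.

Lemma ctK m n (X : 'M[K]_(m, n)) : ct (ct X) = X.
Proof. by apply/matrixP => i j; rewrite !mxE (uq_conjK U). Qed.

Lemma ct1 n : ct (1%:M : 'M[K]_n) = 1%:M.
Proof. by rewrite trmx1 map_mx1. Qed.

Lemma ctB m n (X Y : 'M[K]_(m, n)) : ct (X - Y) = ct X - ct Y.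
Proof. by rewrite linearB map_mxB. Qed.

Lemma ctN m n (X : 'M[K]_(m, n)) : ct (- X) = - ct X.
Proof. by apply/matrixP => i j; rewrite !mxE rmorphN. Qed.

Lemma ctD m n (X Y : 'M[K]_(m, n)) : ct (X + Y) = ct X + ct Y.
Proof. by rewrite linearD map_mxD. Qed.

Lemma ctZ m n a (X : 'M[K]_(m, n)) : ct (a *: X) = conj a *: ct X.
Proof. by rewrite linearZ map_mxZ. Qed.

Lemma ct_quad m n (A : 'M[K]_m) (X : 'M[K]_(m, n)) : ct A = A ->
  ct (ct X *m A *m X) = ct X *m A *m X.
Proof. by move=> cA; rewrite !ctM ctK cA mulmxA. Qed.

(** Each entry is x + u y with x, y fixed and u a skew unit, so it has
    (q^k)^2 classes. *)
Lemma count_mx m n d k :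
  count_mod (@mx_ideal m n (d + k%:Z)) (mx_ideal d) (q ^ (2 * k * (m * n))).
Proof.
have [u [cu u0 uM uV]] := skew_unit.
have [e [Se eI eS]] := count_fixed d k.
have -> : (q ^ (2 * k * (m * n)) =
    #|{: 'M[('I_(q ^ k) * 'I_(q ^ k))%type]_(m, n)}|)%N.
  by rewrite card_mx card_prod !card_ord -expnD expnM addnn -mul2n.
pose f (ij : 'I_(q ^ k) * 'I_(q ^ k)) := e ij.1 + u * e ij.2.
apply: (@transversal_count _ _ _ _ (fun A => map_mx f A)); split.
- move=> A i j; rewrite mxE; have [PA _] := Se (A i j).1; have [PA' _] := Se (A i j).2.
  by apply: (subgroupD (ideal_subgroup d) PA); exact: uM.
- move=> A B AB; apply/matrixP => i j; have := AB i j; rewrite !mxE /f.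
  have [_ ca] := Se (A i j).1; have [_ ca'] := Se (A i j).2.
  have [_ cb] := Se (B i j).1; have [_ cb'] := Se (B i j).2.
  rewrite skewB => /(skew_coord cu u0 uV)[||P1 P2].
  + by rewrite rmorphB ca cb.
  + by rewrite rmorphB ca' cb'.
  rewrite [A i j]surjective_pairing [B i j]surjective_pairing.
  by congr (_, _); apply: eI; split; rewrite ?rmorphB ?ca ?cb ?ca' ?cb'.
move=> X PX.
have ex i j : exists ab, P (d + k%:Z) (X i j - f ab).
  have [x [y [Px Py ->]]] := skew_decomp cu u0 uV (PX i j).
  have [a [Pa _]] := eS _ Px; have [b [Pb _]] := eS _ Py.
  exists (a, b); rewrite /f /= skewB.
  by apply: (subgroupD (ideal_subgroup _) Pa); exact: uM.
exists (\matrix_(i, j) projT1 (cid (ex i j))) => i j.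
by rewrite !mxE; case: cid.
Qed.

(** A hermitian matrix is determined by its fixed diagonal and, off it, by two
    fixed coordinates per pair of opposite entries; they fill a square matrix. *)
Lemma count_herm n d k :
  count_mod (@mx_ideal n n (d + k%:Z)) [set Y | mx_ideal d Y /\ ct Y = Y]
    (q ^ (k * (n * n))).
Proof.
have [u [cu u0 uM uV]] := skew_unit.
have [e [Se eI eS]] := count_fixed d k.
have Pe i : P d (e i) by case: (Se i).
have ce i : conj (e i) = e i by case: (Se i).
rewrite expnM; have -> : ((q ^ k) ^ (n * n) = #|{: 'M['I_(q ^ k)]_n}|)%N.
  by rewrite card_mx card_ord.
pose f (A : 'M['I_(q ^ k)]_n) := \matrix_(i, j)
  if (i < j)%N then e (A i j) + u * e (A j i)
  else if (j < i)%N then e (A j i) - u * e (A i j) else e (A i j).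
apply: (@transversal_count _ _ _ _ f); split.
- move=> A; split.
    move=> i j; rewrite mxE; have sP := ideal_subgroup d.
    case: ifP => _; first by apply: (subgroupD sP (Pe _)); exact: uM.
    case: ifP => _; last exact: Pe.
    by apply: (subgroupB sP (Pe _)); exact: uM.
  apply/matrixP => i j; rewrite !mxE.
  case: (ltngtP i j) => [ij|ji|/val_inj ->]; last by rewrite ce.
    by rewrite rmorphB rmorphM !ce cu mulNr opprK.
  by rewrite rmorphD rmorphM !ce cu mulNr.
- move=> A B AB.
  have h (i j : 'I_n) : (i < j)%N -> A i j = B i j /\ A j i = B j i.
    move=> ij; have := AB i j; rewrite !mxE ij.
    rewrite skewB => /(skew_coord cu u0 uV)[||P1 P2].
    + by rewrite rmorphB !ce.
    + by rewrite rmorphB !ce.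
    by split; apply: eI; split; rewrite ?rmorphB ?ce.
  apply/matrixP => i j; have [ij|ji|/val_inj ij] := ltngtP i j.
  + by have [] := h _ _ ij.
  + by have [] := h _ _ ji.
  subst j; have := AB i i; rewrite !mxE ltnn => Pii.
  by apply: eI; split; rewrite ?rmorphB ?ce.
move=> X [PX cX].
have cXE i j : conj (X i j) = X j i by rewrite -{2}cX !mxE.
have ex i j : exists ab : 'I_(q ^ k) * 'I_(q ^ k),
    P (d + k%:Z) (X i j - (e ab.1 + u * e ab.2)).
  have [x [y [Px Py ->]]] := skew_decomp cu u0 uV (PX i j).
  have [a [Pa _]] := eS _ Px; have [b [Pb _]] := eS _ Py.
  exists (a, b); rewrite /f /= skewB.
  by apply: (subgroupD (ideal_subgroup _) Pa); exact: uM.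
pose g i j := projT1 (cid (ex i j)).
have gP i j : P (d + k%:Z) (X i j - (e (g i j).1 + u * e (g i j).2)).
  by rewrite /g; case: cid.
have ex' i : exists a, P (d + k%:Z) (X i i - e a).
  have [a [Pa _]] : exists a, fixed_ideal (d + k%:Z) (X i i - e a).
    by apply: eS; split; [exact: PX | exact: cXE].
  by exists a.
pose g' i := projT1 (cid (ex' i)).
have gP' i : P (d + k%:Z) (X i i - e (g' i)) by rewrite /g'; case: cid.
exists (\matrix_(i, j) if (i < j)%N then (g i j).1 else
                       if (j < i)%N then (g j i).2 else g' i) => i j.
rewrite !mxE; case: (ltngtP i j) => [ij|ji|/val_inj <-].
- exact: gP.
- have /ideal_conj := gP j i.
  by rewrite rmorphB rmorphD rmorphM !ce cu mulNr cXE.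
- exact: gP'.
Qed.
(** * Matrices invertible over the integers *)

Lemma unit_of_notin_ideal x : O x -> ~ P 1 x -> x != 0 /\ O x^-1.
Proof.
move=> Ox Px; have x0 : x != 0.
  by apply: contra_not_neq Px => ->; exact: subgroup0 (ideal_subgroup 1).
split=> //; have [k [Ok OkV]] := uq_val U x0.
have [k0|k0] := lerP 0 k.
  have -> : x^-1 = w ^ k * (w ^ k * x)^-1 by rewrite invfM mulVKf ?expfz_neq0.
  apply: OM => //; case: k k0 {Ok OkV} => // n _; rewrite -exprnP.
  by apply: OX; exact: (uq_w U).
case: Px; apply: (@ideal_le 1 (- k)); first by lia.
by rewrite /P /= opprK.
Qed.

Lemma principal_unit x : P 1 (x - 1) -> [/\ x != 0, O x & O x^-1].
Proof.
move=> Px; have Ox : O x.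
  rewrite -(subrK 1 x); apply: OD; last exact: (uq_1 U).
  by apply/ideal0; exact: ideal_le Px.
have [|x0 OxV] := unit_of_notin_ideal Ox; last by [].
move=> Px'; apply: (uq_wV U); have := subgroupB (ideal_subgroup 1) Px' Px.
by rewrite /P /= subKr exprN1 mulr1.
Qed.

(** The determinant is a polynomial in the entries, so it respects congruences. *)
Lemma det_congr n (A B : 'M[K]_n) : mx_ideal 0 A -> mx_ideal 0 B ->
  mx_ideal 1 (A - B) -> [/\ O (\det A), O (\det B) & P 1 (\det A - \det B)].
Proof.
move=> OA OB AB; have s1 := ideal_subgroup 1.
pose R x y := [/\ O x, O y & P 1 (x - y)].
have Rrefl x : O x -> R x x by split=> //; rewrite subrr; exact: subgroup0 s1.
have RD x x' y y' : R x x' -> R y y' -> R (x + y) (x' + y').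
  move=> [Ox Ox' xx'] [Oy Oy' yy']; split; [exact: OD | exact: OD |].
  by rewrite opprD addrACA; exact: subgroupD.
have RM x x' y y' : R x x' -> R y y' -> R (x * y) (x' * y').
  move=> [Ox Ox' xx'] [Oy Oy' yy']; split; [exact: OM | exact: OM |].
  have -> : x * y - x' * y' = (x - x') * y + x' * (y - y') by ring.
  apply: subgroupD => //; first by rewrite -[1]addr0; apply: idealM => //; exact/ideal0.
  by rewrite -[1]add0r; apply: idealM => //; exact/ideal0.
have AB' a b : P 1 (A a b - B a b) by have := AB a b; rewrite !mxE.
suff : R (\det A) (\det B) by [].
rewrite /determinant; apply: (big_ind2 R) => [|x x' y y'|s _].
- exact: (Rrefl 0 O0).
- exact: RD.
apply: (RM).
  by apply: Rrefl; apply: OX; apply: ON; exact: (uq_1 U).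
apply: (big_ind2 R) => [|x x' y y'|i _].
- exact: Rrefl (uq_1 U).
- exact: RM.
split; first by apply/ideal0; exact: OA.
  by apply/ideal0; exact: OB.
exact: AB'.
Qed.

Definition integral_unit n (A : 'M[K]_n) :=
  [/\ A \in unitmx, mx_ideal 0 A & mx_ideal 0 (invmx A)].

Lemma mx_ideal_congr m n (X Y : 'M[K]_(m, n)) (d : int) :
  0 <= d -> mx_ideal 0 Y -> mx_ideal d (X - Y) -> mx_ideal 0 X.
Proof.
move=> d0 OY XY; rewrite -(subrK Y X).
by apply: (subgroupD (mx_ideal_subgroup _ _ _)) OY; exact: mx_ideal_le XY.
Qed.

Lemma integral_unit_congr1 n (A : 'M[K]_n) :
  mx_ideal 1 (A - 1%:M) -> integral_unit A.
Proof.
move=> A1; have I1 := @mx_ideal_1 n.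
have OA : mx_ideal 0 A by exact: mx_ideal_congr A1.
have [_ _] := det_congr OA I1 A1; rewrite det1 => /principal_unit[d0 _ OdV].
have uA : A \in unitmx by rewrite unitmxE unitfE.
split=> // i j; rewrite oppr0 expr0z mul1r /invmx uA !mxE.
apply: OM => //; rewrite /cofactor; apply: OM.
  by apply: OX; apply: ON; exact: (uq_1 U).
set B := row' _ _; have OB : mx_ideal 0 B by move=> a b; rewrite !mxE; exact: OA.
have [|//] := det_congr OB OB.
by rewrite subrr; exact: subgroup0 (mx_ideal_subgroup _ _ _).
Qed.

(** The inverse of Y is the inverse of the Gram matrix times Y^*, hence
    integral. *)
Lemma integral_unit_gram n (Y : 'M[K]_n) :
  mx_ideal 0 Y -> mx_ideal 1 (ct Y *m Y - 1%:M) -> integral_unit Y.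
Proof.
move=> OY /integral_unit_congr1[uG _ OG].
have VY : invmx (ct Y *m Y) *m ct Y *m Y = 1%:M by rewrite -mulmxA mulVmx.
have uY : Y \in unitmx by have [] := mulmx1_unit VY.
split=> //; have -> : invmx Y = invmx (ct Y *m Y) *m ct Y.
  by rewrite -[RHS](mulmxK uY) VY mul1mx.
by rewrite -[0]addr0; apply: mx_idealM => //; exact: mx_ideal_conj.
Qed.

(** A Gram matrix of n vectors in dimension t < n is degenerate, hence not a
    unit. *)
Lemma gram_not_congr1 t n (Y : 'M[K]_(t, n)) : (t < n)%N ->
  ~ mx_ideal 1 (ct Y *m Y - 1%:M).
Proof.
move=> tn /integral_unit_congr1[uG _ _].
have /eqP := mxrank_unit uG; rewrite eqn_leq => /andP[_ nG].
have := leq_trans nG (leq_trans (mxrankM_maxr _ _) (rank_leq_row Y)).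
by rewrite leqNgt tn.
Qed.

(** Hermitian matrices congruent to 1 modulo w are, to any precision, of the
    form s^* s: an error e is halved between the two factors, which replaces it by
    terms divisible by (s - 1) e and e^2. *)
Lemma gram_lift n (A : 'M[K]_n) k : ct A = A -> mx_ideal 1 (A - 1%:M) ->
  exists2 s, mx_ideal 1 (s - 1%:M) & mx_ideal k.+1%:Z (ct s *m s - A).
Proof.
move=> cA A1; elim: k => [|k [s s1 sA]].
  exists 1%:M; rewrite ?subrr; first exact: subgroup0 (mx_ideal_subgroup _ _ _).
  rewrite ct1 mulmx1 -opprB; exact: subgroupN (mx_ideal_subgroup _ _ _) _.
have sI m' n' d := @mx_ideal_subgroup m' n' d.
pose e := A - ct s *m s; have ce : ct e = e by rewrite ctB ctM ctK cA.
have Pe : mx_ideal k.+1%:Z e by exact: subgroup_sym (sI _ _ _) sA.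
pose h := 2^-1 *: e; have Ph : mx_ideal k.+1%:Z h by exact: mx_ideal_half.
have ch : ct h = h by rewrite ctZ ce fmorphV rmorph_nat.
have hh : h + h = e.
  rewrite -scalerDl -[2^-1]mul1r -mulrDl -[1 + 1]/(2 : K) divff ?scale1r //.
  exact: (uq_two U).
have Ph1 : mx_ideal 1 h by apply: mx_ideal_le Ph.
exists (s + h); first by rewrite addrAC; exact: (subgroupD (sI _ _ _)).
apply: (subgroup_sym (sI _ _ _)).
have -> : A - ct (s + h) *m (s + h) =
    ct (1%:M - s) *m h + h *m (1%:M - s) - h *m h.
  rewrite ctD ch ctB ct1 !(mulmxDl, mulmxDr, mulmxN, mulNmx) mul1mx mulmx1.
  rewrite -[A](subrK (ct s *m s)) -/e -hh.
  move: (ct s *m s) (ct s *m h) (h *m s) (h *m h) => a b c d.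
  by apply/matrixP => i j; rewrite !mxE; ring.
have s1' : mx_ideal 1 (1%:M - s) by exact: subgroup_sym (sI _ _ _) s1.
have -> : k.+2%:Z = 1 + k.+1%:Z by rewrite -PoszD add1n.
apply: (subgroupB (sI _ _ _)); last exact: mx_idealM.
apply: (subgroupD (sI _ _ _)); first by apply: mx_idealM => //; exact: mx_ideal_conj.
by rewrite addrC; apply: mx_idealM.
Qed.
(** * Counting solutions of congruences *)

Definition represents m n (A : 'M[K]_m) (B : 'M[K]_n) j : set 'M[K]_(m, n) :=
  [set X | mx_ideal 0 X /\ mx_ideal j (ct X *m A *m X - B)].

Lemma quad_congr m n d (A : 'M[K]_m) (X Y : 'M[K]_(m, n)) : 0 <= d ->
  mx_ideal 0 A -> mx_ideal 0 X -> mx_ideal d (Y - X) ->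
  mx_ideal d (ct Y *m A *m Y - ct X *m A *m X).
Proof.
move=> d0 OA OX' XY; have sI m' n' d' := @mx_ideal_subgroup m' n' d'.
have OY : mx_ideal 0 Y by exact: mx_ideal_congr XY.
have -> : ct Y *m A *m Y - ct X *m A *m X
  = ct (Y - X) *m (A *m Y) + ct X *m A *m (Y - X).
  by rewrite ctB mulmxBl mulmxBr !mulmxA addrA subrK.
have OAY : mx_ideal 0 (A *m Y) by rewrite -[0]addr0; exact: mx_idealM.
have OXA : mx_ideal 0 (ct X *m A).
  by rewrite -[0]addr0; apply: mx_idealM => //; exact: mx_ideal_conj.
apply: (subgroupD (sI _ _ _)).
  by rewrite -[d]addr0; apply: mx_idealM => //; exact: mx_ideal_conj.
by rewrite -[d]add0r; apply: mx_idealM.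
Qed.

Lemma represents_invariant m n (A : 'M[K]_m) (B : 'M[K]_n) j d :
  0 <= d -> j <= d -> mx_ideal 0 A ->
  invariant_mod (mx_ideal d) (represents A B j).
Proof.
move=> d0 jd OA X Y [OX' XB] XY; split; first exact: mx_ideal_congr XY.
apply: (subgroup_trans (y := ct X *m A *m X) (mx_ideal_subgroup _ _ _)) XB.
by apply: mx_ideal_le jd _ _; exact: quad_congr.
Qed.

Lemma count_represents_exists m n (A : 'M[K]_m) (B : 'M[K]_n) j k :
  j <= k%:Z -> mx_ideal 0 A ->
  exists c, count_mod (@mx_ideal m n k%:Z) (represents A B j) c.
Proof.
move=> jk OA; have C := count_mx m n 0 k; rewrite add0r in C.
apply: (count_mod_sub (mx_ideal_subgroup _ _ _) _ _ C); first by move=> X [].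
exact: represents_invariant.
Qed.

Lemma mx_ideal0M m n k d (X : 'M[K]_(m, n)) (Y : 'M[K]_(n, k)) :
  mx_ideal 0 X -> mx_ideal d Y -> mx_ideal d (X *m Y).
Proof. by move=> OX' PY; rewrite -[d]add0r; exact: mx_idealM. Qed.

Lemma mx_idealM0 m n k d (X : 'M[K]_(m, n)) (Y : 'M[K]_(n, k)) :
  mx_ideal d X -> mx_ideal 0 Y -> mx_ideal d (X *m Y).
Proof. by move=> PX OY; rewrite -[d]addr0; exact: mx_idealM. Qed.

Lemma ct_invmx n (g : 'M[K]_n) : ct (invmx g) = invmx (ct g).
Proof. by rewrite trmx_inv map_invmx. Qed.

(** Right translation by an approximate square root of H carries the
    representations of 1 to those of H. *)
Lemma count_represents_mulr m n (A : 'M[K]_m) (g H : 'M[K]_n) j d c :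
  0 <= d -> integral_unit g -> mx_ideal j (ct g *m g - H) ->
  count_mod (@mx_ideal m n d) (represents A 1%:M j) c ->
  count_mod (@mx_ideal m n d) (represents A H j) c.
Proof.
move=> d0 [ug Og OgV] gH; have sI m' n' d' := @mx_ideal_subgroup m' n' d'.
have OgV' : mx_ideal 0 (ct (invmx g)) by exact: mx_ideal_conj.
have Og' : mx_ideal 0 (ct g) by exact: mx_ideal_conj.
apply: (count_mod_bij (f := fun Y => Y *m g)) => //.
- move=> Y [OY Y1]; split; first exact: mx_idealM0.
  have -> : ct (Y *m g) *m A *m (Y *m g) - H =
      ct g *m (ct Y *m A *m Y - 1%:M) *m g + (ct g *m g - H).
    by rewrite ctM mulmxBr mulmxBl mulmx1 !mulmxA addrA subrK.
  by apply: (subgroupD (sI _ _ _)) gH; apply: mx_idealM0 => //; exact: mx_ideal0M.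
- by move=> X Y _ _ XY; rewrite -mulmxBl; exact: mx_idealM0.
- move=> X Y _ _; rewrite -mulmxBl => XY.
  by rewrite -(mulmxK ug (X - Y)); exact: mx_idealM0.
move=> Y [OY YH]; exists (Y *m invmx g); last first.
  by rewrite mulmxKV // subrr; exact: subgroup0 (sI _ _ _).
split; first exact: mx_idealM0.
have -> : ct (Y *m invmx g) *m A *m (Y *m invmx g) - 1%:M =
    ct (invmx g) *m ((ct Y *m A *m Y - H) - (ct g *m g - H)) *m invmx g.
  rewrite opprB addrA subrK ctM mulmxBr mulmxBl !mulmxA; congr (_ - _).
  by rewrite -ctM mulmxV // ct1 mul1mx mulmxV.
apply: mx_idealM0 => //; apply: mx_ideal0M => //.
exact: (subgroupB (sI _ _ _)).
Qed.

(** Left multiplication by h carries the representations by A to those by the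
    form 1, which gives the same number for all A of the form h^* h. *)
Lemma count_represents_mull m n (A h : 'M[K]_m) (B : 'M[K]_n) (j d : int) c :
  0 <= d -> integral_unit h -> mx_ideal j (ct h *m h - A) ->
  count_mod (@mx_ideal m n d) (represents 1%:M B j) c ->
  count_mod (@mx_ideal m n d) (represents A B j) c.
Proof.
move=> d0 [uh Oh OhV] hA; have sI m' n' d' := @mx_ideal_subgroup m' n' d'.
have key (Z : 'M[K]_(m, n)) : mx_ideal 0 Z ->
    mx_ideal j (ct (h *m Z) *m 1%:M *m (h *m Z) - ct Z *m A *m Z).
  move=> OZ.
  have -> : ct (h *m Z) *m 1%:M *m (h *m Z) - ct Z *m A *m Z =
      ct Z *m (ct h *m h - A) *m Z.
    by rewrite ctM mulmx1 mulmxBr mulmxBl !mulmxA.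
  by apply: mx_idealM0 => //; apply: mx_ideal0M => //; exact: mx_ideal_conj.
apply: (count_mod_bij (f := fun Y => invmx h *m Y)) => //.
- move=> Y [OY YB]; have OZ : mx_ideal 0 (invmx h *m Y) by exact: mx_ideal0M.
  split=> //; apply: (subgroup_trans (sI _ _ _) (subgroup_sym (sI _ _ _) (key _ OZ))).
  by rewrite mulKVmx.
- by move=> X Y _ _ XY; rewrite -mulmxBr; exact: mx_ideal0M.
- move=> X Y _ _; rewrite -mulmxBr => XY.
  by rewrite -(mulKVmx uh (X - Y)); exact: mx_ideal0M.
move=> Y [OY YB]; exists (h *m Y).
  split; first exact: mx_ideal0M.
  exact: (subgroup_trans (sI _ _ _) (key _ OY)).
by rewrite mulKmx // subrr; exact: subgroup0 (sI _ _ _).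
Qed.

(** The solutions modulo w are spread evenly over the hermitian matrices H
    congruent to 1 modulo w by Y |-> Y^* Y, since each such H is some g^* g; so
    passing from w to w^(k+1) divides the density by the number of those H. *)
Lemma count_unitary n : exists2 s, (0 < s)%N & forall k : nat,
  count_mod (@mx_ideal n n k.+1%:Z) (represents 1%:M (1%:M : 'M[K]_n) k.+1%:Z)
    (s * q ^ (k * (n * n))).
Proof.
have sI m' n' d' := @mx_ideal_subgroup m' n' d'.
have I1 := @mx_ideal_1 n.
have [s sP] := @count_represents_exists _ _ 1%:M (1%:M : 'M[K]_n) 1 1 (lexx _) I1.
have q0 := residue_gt0.
exists s.
  apply: (count_mod_gt0 (x := 1%:M) sP); split=> //.
  by rewrite ct1 !mulmx1 subrr; exact: subgroup0 (sI _ _ _).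
move=> k; have [s' s'P] := @count_represents_exists _ _ 1%:M (1%:M : 'M[K]_n)
  k.+1%:Z k.+1 (lexx _) I1.
suff -> : (s * q ^ (k * (n * n)) = s')%N by [].
have C1 : count_mod (@mx_ideal n n k.+1%:Z) (represents 1%:M (1%:M : 'M[K]_n) 1)
    (s * q ^ (2 * k * (n * n))).
  apply: (count_mod_tower (L' := mx_ideal 1)) => //.
  - by apply: mx_ideal_le; rewrite lez_nat.
  - exact: represents_invariant.
  - by have := count_mx n n 1 k; rewrite -PoszD add1n.
have C2 : count_mod (@mx_ideal n n k.+1%:Z) (represents 1%:M (1%:M : 'M[K]_n) 1)
    (q ^ (k * (n * n)) * s').
  have := count_herm n 1 k; rewrite -PoszD add1n => CH.
  apply: (count_mod_fibers (f := fun Y => ct Y *m 1%:M *m Y - 1%:M) _ _ _ _ CH) => //.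
  - move=> Y [OY Y1]; split => //.
    by rewrite mulmx1 ctB ctM ctK ct1.
  - move=> X Y [OX' _] [OY _] XY.
    by rewrite opprB addrA subrK; apply: quad_congr.
  move=> H [H1 cH].
  have cH1 : ct (1%:M + H) = 1%:M + H by rewrite ctD ct1 cH.
  have [|g g1 gH] := gram_lift k cH1; first by rewrite addrC addKr.
  have ug := integral_unit_congr1 g1.
  have := count_represents_mulr _ ug gH s'P.
  suff -> : represents 1%:M (1%:M + H) k.+1%:Z = [set x : 'M[K]_n | represents 1%:M 1%:M 1 x /\
      mx_ideal k.+1%:Z (ct x *m 1%:M *m x - 1%:M - H)] by apply.
  apply/seteqP; split=> Y /=.
    move=> [OY YH]; have YH' : mx_ideal k.+1%:Z (ct Y *m 1%:M *m Y - 1%:M - H).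
      by rewrite -addrA -opprD.
    split=> //; split=> //; rewrite -(subrK H (_ - 1%:M)).
    by apply: (subgroupD (sI _ _ _)) H1; apply: mx_ideal_le YH'; rewrite lez_nat.
  by move=> [[OY _] YH]; split=> //; rewrite opprD addrA.
have := count_mod_unique (sI _ _ _) C1 C2.
rewrite -[(2 * k * _)%N]mulnA mul2n -addnn expnD mulnA [RHS]mulnC => /eqP.
by rewrite eqn_pmul2r ?expn_gt0 ?q0 // => /eqP.
Qed.
(** * Representations of diag(B1, 1/w) in blocks *)

Section Assemble.
Variables n l : nat.
Implicit Types (Z V : 'M[K]_(n + l, n)) (Q Y : 'M[K]_n) (X : 'M[K]_(n + n + l, n + n)).

(** The blocks of X: the rows come in groups of n rows of weight 1, n rows of
    weight 1/w and l rows of weight 1, and the columns in two groups of n. Z and V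
    collect the rows of weight 1, Q and Y those of weight 1/w. *)
Definition assemble Z V Q Y : 'M[K]_(n + n + l, n + n) :=
  col_mx (block_mx (usubmx Z) (usubmx V) Q Y) (row_mx (dsubmx Z) (dsubmx V)).

Definition part_Z X : 'M[K]_(n + l, n) :=
  col_mx (ulsubmx (usubmx X)) (lsubmx (dsubmx X)).
Definition part_V X : 'M[K]_(n + l, n) :=
  col_mx (ursubmx (usubmx X)) (rsubmx (dsubmx X)).
Definition part_Q X : 'M[K]_n := dlsubmx (usubmx X).
Definition part_Y X : 'M[K]_n := drsubmx (usubmx X).

Lemma assemble_parts X : X = assemble (part_Z X) (part_V X) (part_Q X) (part_Y X).
Proof.
by rewrite /assemble /part_Z /part_V !col_mxKu !col_mxKd submxK hsubmxK vsubmxK.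
Qed.

Lemma part_V_assemble Z V Q Y : part_V (assemble Z V Q Y) = V.
Proof.
by rewrite /part_V col_mxKu col_mxKd block_mxKur row_mxKr vsubmxK.
Qed.
Lemma part_Q_assemble Z V Q Y : part_Q (assemble Z V Q Y) = Q.
Proof. by rewrite /part_Q col_mxKu block_mxKdl. Qed.
Lemma part_Y_assemble Z V Q Y : part_Y (assemble Z V Q Y) = Y.
Proof. by rewrite /part_Y col_mxKu block_mxKdr. Qed.

Lemma assembleB Z V Q Y Z' V' Q' Y' :
  assemble Z V Q Y - assemble Z' V' Q' Y' =
  assemble (Z - Z') (V - V') (Q - Q') (Y - Y').
Proof.
rewrite /assemble opp_col_mx opp_block_mx opp_row_mx add_col_mx add_block_mx.
by rewrite add_row_mx; congr (col_mx (block_mx _ _ _ _) (row_mx _ _)); rewrite linearB.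
Qed.

Lemma mx_ideal_col m1 m2 k d (A : 'M[K]_(m1, k)) (B : 'M[K]_(m2, k)) :
  mx_ideal d (col_mx A B) <-> mx_ideal d A /\ mx_ideal d B.
Proof.
split=> [AB|[PA PB] i j]; last by rewrite mxE; case: (fintype.split i).
by split=> i j; [have := AB (lshift _ i) j; rewrite col_mxEu|
                 have := AB (rshift _ i) j; rewrite col_mxEd].
Qed.

Lemma mx_ideal_row m k1 k2 d (A : 'M[K]_(m, k1)) (B : 'M[K]_(m, k2)) :
  mx_ideal d (row_mx A B) <-> mx_ideal d A /\ mx_ideal d B.
Proof.
split=> [AB|[PA PB] i j]; last by rewrite mxE; case: (fintype.split j).
by split=> i j; [have := AB i (lshift _ j); rewrite row_mxEl|
                 have := AB i (rshift _ j); rewrite row_mxEr].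
Qed.

Lemma mx_ideal_block m1 m2 k1 k2 d (A : 'M[K]_(m1, k1)) (B : 'M[K]_(m1, k2))
    (C : 'M[K]_(m2, k1)) (D : 'M[K]_(m2, k2)) :
  mx_ideal d (block_mx A B C D) <->
  [/\ mx_ideal d A, mx_ideal d B, mx_ideal d C & mx_ideal d D].
Proof.
rewrite /block_mx mx_ideal_col !mx_ideal_row.
by split=> [[[? ?] [? ?]]|[]].
Qed.

Lemma mx_ideal_assemble d Z V Q Y : mx_ideal d (assemble Z V Q Y) <->
  [/\ mx_ideal d Z, mx_ideal d V, mx_ideal d Q & mx_ideal d Y].
Proof.
rewrite mx_ideal_col mx_ideal_block mx_ideal_row.
have /propext hZ := mx_ideal_col d (usubmx Z) (dsubmx Z); rewrite vsubmxK in hZ.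
have /propext hV := mx_ideal_col d (usubmx V) (dsubmx V); rewrite vsubmxK in hV.
rewrite hZ hV; by split=> [[[? ? ? ?] [? ?]]|[[? ?] [? ?] ? ?]].
Qed.

(** The matrix A_n^{[r]}, for l = 2r. *)
Definition split_form : 'M[K]_(n + n + l) :=
  block_mx (block_mx 1%:M 0 0 (w^-1)%:M) 0 0 1%:M.

Lemma split_formE Z V Q Y :
  ct (assemble Z V Q Y) *m split_form *m assemble Z V Q Y =
  block_mx (ct Z *m Z + w^-1 *: (ct Q *m Q)) (ct Z *m V + w^-1 *: (ct Q *m Y))
           (ct V *m Z + w^-1 *: (ct Y *m Q)) (ct V *m V + w^-1 *: (ct Y *m Y)).
Proof.
have split2 k (A B : 'M[K]_(n + l, k)) :
    ct A *m B = ct (usubmx A) *m usubmx B + ct (dsubmx A) *m dsubmx B.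
  by rewrite -{1}(vsubmxK A) -{1}(vsubmxK B) tr_col_mx map_row_mx mul_row_col.
rewrite /assemble /split_form tr_col_mx map_row_mx tr_row_mx map_col_mx.
rewrite tr_block_mx map_block_mx mul_row_block !mulmx0 addr0 add0r mulmx1.
rewrite mul_row_col mulmx_block !mulmx0 !mulmx1 !addr0 !add0r.
rewrite mulmx_block mul_col_row add_block_mx !split2.
rewrite !mul_mx_scalar -!scalemxAl.
by congr block_mx; rewrite addrAC.
Qed.

(** The solutions of A[X] = diag(B1, 1/w) modulo w^k in the support of
    1_{n,n}. *)
Definition split_reps (B1 : 'M[K]_n) (k : int) : set 'M[K]_(n + n + l, n + n) :=
  [set X | [/\ mx_ideal 0 X, mx_ideal 1 (part_Q X) &
    mx_ideal k (ct X *m split_form *m X - block_mx B1 0 0 (w^-1)%:M)]].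

Lemma wVw m k (A : 'M[K]_(m, k)) : w^-1 *: (w *: A) = A.
Proof. by rewrite scalerA mulVf // scale1r. Qed.

Lemma mx_ideal_w m k d (A : 'M[K]_(m, k)) : mx_ideal (d + 1) (w *: A) = mx_ideal d A.
Proof. by have := mx_ideal_scale d 1 A; rewrite expr1z => /propext ->. Qed.

(** The factor w in the block w Q cancels the weight 1/w. The third condition
    gains a power of w because the weight 1/w of Y^* Y is cleared. *)
Lemma split_repsP B1 (k : nat) Z V Q Y : ct B1 = B1 ->
  split_reps B1 k%:Z (assemble Z V (w *: Q) Y) <->
  [/\ mx_ideal 0 Z, mx_ideal 0 V, mx_ideal 0 Q & mx_ideal 0 Y] /\
  [/\ mx_ideal k%:Z (ct Z *m Z + w *: (ct Q *m Q) - B1),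
      mx_ideal k%:Z (ct V *m Z + ct Y *m Q) &
      mx_ideal k.+1%:Z (ct Y *m 1%:M *m Y - (1%:M - w *: (ct V *m V)))].
Proof.
move=> cB1; rewrite /split_reps /= split_formE part_Q_assemble (propext (mx_ideal_assemble _ _ _ _ _)).
rewrite opp_block_mx add_block_mx (propext (mx_ideal_block _ _ _ _ _)) !oppr0 !addr0.
have eQ : mx_ideal 1 (w *: Q) = mx_ideal 0 Q by rewrite -(mx_ideal_w 0) add0r.
rewrite eQ ctZ (uq_conjw U) -!scalemxAl -!scalemxAr !wVw.
rewrite -[k.+1]addn1 PoszD.
have -> : ct Y *m 1%:M *m Y - (1%:M - w *: (ct V *m V)) =
    w *: (ct V *m V + w^-1 *: (ct Y *m Y) - (w^-1)%:M).
  rewrite mulmx1 opprB !scalerDr scalerN scalerA divff // scale1r scale_scalar_mx.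
  by rewrite divff // [in RHS]addrC !addrA [RHS]addrAC [- _ + _]addrC addrAC.
rewrite mx_ideal_w.
have sym : mx_ideal k%:Z (ct V *m Z + ct Y *m Q) ->
    mx_ideal k%:Z (ct Z *m V + ct Q *m Y).
  by move/mx_ideal_conj; rewrite ctD !ctM !ctK.
split=> [[[OZ OV _ OY] OQ [P1 _ P2 P3]]|[[OZ OV OQ OY] [P1 P2 P3]]]; first by [].
split=> //; last by split=> //; exact: sym.
by split=> //; apply: (mx_ideal_le (b := 1)); rewrite ?eQ.
Qed.

End Assemble.

Section CountSplit.
Variables (n l : nat) (B1 : 'M[K]_n) (k : nat).
Hypothesis cB1 : ct B1 = B1.
Implicit Types (X : 'M[K]_(n + n + l, n + n)).
Local Notation kS := (k.+1%:Z).
Let sI m' n' d' := @mx_ideal_subgroup m' n' d'.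

Lemma assemble_congr d X X' : mx_ideal d (X - X') <->
  [/\ mx_ideal d (part_Z X - part_Z X'), mx_ideal d (part_V X - part_V X'),
      mx_ideal d (part_Q X - part_Q X') & mx_ideal d (part_Y X - part_Y X')].
Proof.
by rewrite [X in mx_ideal d (X - _)]assemble_parts
           [X' in mx_ideal d (_ - X')]assemble_parts assembleB mx_ideal_assemble.
Qed.

Lemma mx_ideal_scalew m n' d (A : 'M[K]_(m, n')) : mx_ideal d A -> mx_ideal d (w *: A).
Proof. by move=> PA; apply: (@mx_ideal_le _ _ d (d + 1)); rewrite ?lerDl // mx_ideal_w. Qed.

(** The fibre over given V and Y: if N is the solution of Y^* N = V^*, the second
    condition gives Q = - N Z modulo w^k, and then the first one is A[Z] = B1 for the form
    A = 1 + w N^* N, which is equivalent to 1. *)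
Lemma count_split_fiber (V : 'M[K]_(n + l, n)) (Y : 'M[K]_n) a :
  mx_ideal 0 V -> mx_ideal 0 Y ->
  mx_ideal kS (ct Y *m 1%:M *m Y - (1%:M - w *: (ct V *m V))) ->
  count_mod (@mx_ideal (n + l) n k%:Z) (represents 1%:M B1 k%:Z) a ->
  count_mod (mx_ideal kS) [set X | (split_reps B1 k%:Z X /\
      mx_ideal kS (part_V X - V)) /\ mx_ideal kS (part_Y X - Y)]
    (a * q ^ (2 * 1 * ((n + l) * n))).
Proof.
move=> OV OY PY Ca.
have OcV : mx_ideal 0 (ct V) by exact: mx_ideal_conj.
have OcY : mx_ideal 0 (ct Y) by exact: mx_ideal_conj.
have w1 m' n' (A : 'M[K]_(m', n')) : mx_ideal 0 A -> mx_ideal 1 (w *: A).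
  by move=> OA; rewrite -[1]add0r mx_ideal_w.
have [uY _ OYV] : integral_unit Y.
  apply: integral_unit_gram => //.
  apply: (subgroup_trans (y := 1%:M - w *: (ct V *m V)) (sI _ _ _)).
    by move: PY; rewrite mulmx1; apply: mx_ideal_le; rewrite lez_nat.
  rewrite addrAC subrr add0r; apply: (subgroupN (sI _ _ _)); apply: w1.
  exact: mx_ideal0M.
have OYcV : mx_ideal 0 (invmx (ct Y)) by rewrite -ct_invmx; exact: mx_ideal_conj.
have ucY : ct Y \in unitmx by rewrite map_unitmx unitmx_tr.
pose N : 'M[K]_(n, n + l) := invmx (ct Y) *m ct V.
have ON : mx_ideal 0 N by exact: mx_ideal0M.
have OcN : mx_ideal 0 (ct N) by exact: mx_ideal_conj.
pose A : 'M[K]_(n + l) := 1%:M + w *: (ct N *m N).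
have cA : ct A = A by rewrite ctD ct1 ctZ (uq_conjw U) ctM ctK.
have OA : mx_ideal 0 A.
  apply: (subgroupD (sI _ _ _)); first exact: mx_ideal_1.
  by apply: mx_ideal_scalew; exact: mx_ideal0M.
have [|h h1 hA] := gram_lift k cA.
  by rewrite addrAC subrr add0r; apply: w1; exact: mx_ideal0M.
have {}hA : mx_ideal k%:Z (ct h *m h - A) by apply: mx_ideal_le hA; rewrite lez_nat.
have quadA Z : ct Z *m A *m Z = ct Z *m Z + w *: (ct (- (N *m Z)) *m (- (N *m Z))).
  rewrite mulmxDr mulmx1 mulmxDl -scalemxAr -scalemxAl; congr (_ + _ *: _).
  by rewrite ctN mulNmx mulmxN opprK !ctM !mulmxA.
have YN Z : ct Y *m (N *m Z) = ct V *m Z.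
  by rewrite /N -!mulmxA mulKVmx.
have Ca' : count_mod (@mx_ideal (n + l) n kS) (represents 1%:M B1 k%:Z)
    (a * q ^ (2 * 1 * ((n + l) * n))).
  have := count_mx (n + l) n k 1; rewrite -PoszD addn1 => C1.
  apply: (count_mod_tower _ _ _ _ Ca C1) => //.
    by apply: mx_ideal_le; rewrite lez_nat.
  by apply: represents_invariant => //; exact: mx_ideal_1.
have Ca'' : count_mod (@mx_ideal (n + l) n kS) (represents A B1 k%:Z)
    (a * q ^ (2 * 1 * ((n + l) * n))).
  by apply: (count_represents_mull _ (integral_unit_congr1 h1) hA Ca').
pose f Z := assemble Z V (w *: (- (N *m Z))) Y.
apply: (count_mod_bij (f := f) _ _ _ _ _ Ca''); first exact: sI.
- move=> Z [OZ ZB]; rewrite /= /f part_V_assemble part_Y_assemble !subrr.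
  split; last exact: subgroup0 (sI _ _ _).
  split; last exact: subgroup0 (sI _ _ _).
  apply/(split_repsP _ _ _ _ _ cB1); split.
    split=> //; apply: (subgroupN (sI _ _ _)); exact: mx_ideal0M.
  split=> //; first by rewrite -quadA.
  by rewrite mulmxN YN subrr; exact: subgroup0 (sI _ _ _).
- move=> Z Z' _ _ ZZ'; rewrite /f assembleB mx_ideal_assemble !subrr.
  split=> //; try exact: subgroup0 (sI _ _ _).
  rewrite -scalerBr; apply: mx_ideal_scalew.
  by rewrite -opprD -mulmxBr; apply: (subgroupN (sI _ _ _)); exact: mx_ideal0M.
- by move=> Z Z' _ _; rewrite /f assembleB mx_ideal_assemble => -[].
move=> X [[TX VX] YX].
pose Q := w^-1 *: part_Q X.
have QE : part_Q X = w *: Q by rewrite /Q scalerA divff // scale1r.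
move: TX; rewrite [X in split_reps _ _ X]assemble_parts QE.
move=> /(split_repsP _ _ _ _ _ cB1)[[OZ OVX OQ OYX] [P1 P2 P3]].
set Z := part_Z X in OZ P1 P2 *.
have NQ : mx_ideal k%:Z (Q + N *m Z).
  have -> : Q + N *m Z = invmx (ct Y) *m (ct V *m Z + ct Y *m Q).
    by rewrite mulmxDr mulKmx // mulmxA addrC.
  apply: mx_ideal0M => //.
  have -> : ct V *m Z + ct Y *m Q = (ct (part_V X) *m Z + ct (part_Y X) *m Q)
     - (ct (part_V X - V) *m Z + ct (part_Y X - Y) *m Q).
    rewrite !ctB !mulmxBl opprD !opprB addrACA.
    by rewrite ![_ + (_ - _)]addrC !subrK.
  apply: (subgroupB (sI _ _ _)) => //; apply: (subgroupD (sI _ _ _)).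
    apply: mx_idealM0 => //; apply: mx_ideal_conj; apply: mx_ideal_le VX.
    by rewrite lez_nat.
  apply: mx_idealM0 => //; apply: mx_ideal_conj; apply: mx_ideal_le YX.
  by rewrite lez_nat.
exists Z.
  split=> //; rewrite quadA.
  apply: (subgroup_trans (sI _ _ _) _ P1).
  rewrite opprD addrACA subrr add0r -scalerBr; apply: mx_ideal_scalew.
  have := @quad_congr _ _ k%:Z 1%:M Q (- (N *m Z)); rewrite !mulmx1; apply=> //.
    exact: mx_ideal_1.
  by rewrite -opprD addrC; exact: (subgroupN (sI _ _ _)).
rewrite {1}(assemble_parts X) QE /f assembleB mx_ideal_assemble subrr; split=> //.
  exact: subgroup0 (sI _ _ _).
by rewrite -scalerBr opprK -addn1 PoszD mx_ideal_w.
Qed.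

(** The solutions are fibred over V, which is arbitrary, and then over Y, for
    which the number of choices does not depend on V. Modulo w^(k+1) the block
    w Q is determined, while Z is only constrained modulo w^k; hence the last
    power of q. *)
Lemma count_split_reps s a :
  count_mod (@mx_ideal n n kS) (represents 1%:M 1%:M kS) s ->
  count_mod (@mx_ideal (n + l) n k%:Z) (represents 1%:M B1 k%:Z) a ->
  count_mod (mx_ideal kS) (@split_reps n l B1 k%:Z)
    (q ^ (2 * k.+1 * ((n + l) * n)) * (s * (a * q ^ (2 * 1 * ((n + l) * n))))).
Proof.
move=> Cs Ca.
have CV := count_mx (n + l) n 0 k.+1; rewrite add0r in CV.
apply: (count_mod_fibers (f := @part_V n l) _ _ _ _ CV) => //.
- move=> X; rewrite {1}(assemble_parts X) => -[OX' _ _].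
  by move: OX'; rewrite mx_ideal_assemble => -[].
- by move=> X X' _ _ /assemble_congr[].
move=> V OV; have cV : ct (ct V *m V) = ct V *m V by rewrite ctM ctK.
have [||g g1 gH] := @gram_lift _ (1%:M - w *: (ct V *m V)) k.
- by rewrite ctB ct1 ctZ (uq_conjw U) cV.
- rewrite addrAC subrr add0r; apply: (subgroupN (sI _ _ _)).
  rewrite -[1]add0r mx_ideal_w; apply: mx_ideal0M => //; exact: mx_ideal_conj.
have CY : count_mod (@mx_ideal n n kS)
    (represents 1%:M (1%:M - w *: (ct V *m V)) kS) s.
  by apply: (count_represents_mulr _ (integral_unit_congr1 g1) gH Cs).
apply: (count_mod_fibers (f := @part_Y n l) _ _ _ _ CY) => //.
- move=> X [+ VX]; have QE : part_Q X = w *: (w^-1 *: part_Q X).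
    by rewrite scalerA divff // scale1r.
  rewrite [X in split_reps _ _ X]assemble_parts QE.
  move=> /(split_repsP _ _ _ _ _ cB1)[[OZ OVX OQ OYX] [P1 P2 P3]].
  split=> //; apply: (subgroup_trans (sI _ _ _) P3).
  rewrite opprB addrC addrA subrK -scalerBr -opprB scalerN.
  apply: (subgroupN (sI _ _ _)); apply: mx_ideal_scalew.
  have := @quad_congr _ _ kS 1%:M V (part_V X); rewrite !mulmx1; apply => //.
  exact: mx_ideal_1.
- by move=> X X' _ _ /assemble_congr[].
move=> Y [OY PY]; exact: count_split_fiber.
Qed.

End CountSplit.
End Lattices.

(** * Orthogonality of the additive character *)

Section Duality.
Context (K : fieldType) (conj : {rmorphism K -> K}) (O : set K) (w : K) (q : nat).
Hypothesis U : unramified_quadratic conj O w q.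
Local Notation ct X := (map_mx conj X^T).
Local Notation P := (ideal O w).
Local Notation mxP := (mx_ideal O w).

Lemma hermmxP k (Y : hermmx conj k) : ct (Y : 'M[K]_k) = Y.
Proof. by case: Y => Y /= /sesquiP; rewrite expr0 scale1r => <-. Qed.

Lemma sesqui_ct k (Y : 'M[K]_k) : (Y \is (false, conj).-sesqui) = (ct Y == Y).
Proof. by apply/sesquiP/eqP; rewrite expr0 scale1r => /esym. Qed.

Definition hermmx_of k (Y : 'M[K]_k) (cY : ct Y = Y) : hermmx conj k :=
  @HermMx _ conj _ Y (etrans (sesqui_ct Y) (introT eqP cY)).

Lemma hermmxB k (X Y : hermmx conj k) : hermmx_val (X - Y) = hermmx_val X - hermmx_val Y.
Proof. exact: (raddfB (\val : hermmx conj k -> _) X Y). Qed.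

Definition herm_ideal k d : set (hermmx conj k) := [set Y | mxP d (Y : 'M[K]_k)].

Lemma herm_ideal_subgroup k d : subgroup (@herm_ideal k d).
Proof.
have sI := mx_ideal_subgroup U k k d; split; last first.
  by move=> X Y PX PY; have := subgroupB sI PX PY; rewrite -hermmxB.
have := subgroup0 sI; rewrite -(subrr (hermmx_val (0 : hermmx conj k))) -hermmxB.
by rewrite subrr.
Qed.

Lemma count_herm_ideal n d k :
  count_mod (@herm_ideal n (d + k%:Z)) (herm_ideal d) (q ^ (k * (n * n))).
Proof.
have [e [Se eI eS]] := count_herm U n d k.
exists (fun i => hermmx_of (Se i).2); split.
- by move=> i; exact: (Se i).1.
- by move=> i j Pij; apply: eI; move: Pij; rewrite /herm_ideal /=.
move=> Y PY; have [i Pi] := eS Y (Logic.conj PY (hermmxP Y)).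
by exists i; rewrite /herm_ideal /=.
Qed.

Lemma tr_herm k (X Y : 'M[K]_k) : ct X = X -> ct Y = Y ->
  conj (\tr (X *m Y)) = \tr (X *m Y).
Proof.
move=> cX cY; rewrite -[RHS]mxtrace_mulC -{1}cX -{1}cY.
rewrite -map_mxM /= -trmx_mul /mxtrace rmorph_sum; apply: eq_bigr => i _.
by rewrite !mxE (uq_conjK U).
Qed.

Lemma ideal_tr k a b (X Y : 'M[K]_k) : mxP a X -> mxP b Y -> P (a + b) (\tr (X *m Y)).
Proof.
move=> PX PY; have PXY := mx_idealM U PX PY.
rewrite /mxtrace; apply: (big_ind (P (a + b))) => [|x y|i _].
- exact: subgroup0 (ideal_subgroup U _).
- exact: subgroupD (ideal_subgroup U _).
- exact: PXY.
Qed.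

Context (C : fieldType) (chi : K -> C).
Hypothesis chiD : forall x y, conj x = x -> conj y = y -> chi (x + y) = chi x * chi y.
Hypothesis chiO : forall x, conj x = x -> O x -> chi x = 1.
Hypothesis chi_nontriv : exists x, [/\ conj x = x, O x & chi (w^-1 * x) != 1].

Lemma chi_congr x y : conj x = x -> conj y = y -> O (x - y) -> chi x = chi y.
Proof.
move=> cx cy Oxy; rewrite -(subrK y x) chiD ?rmorphB ?cx ?cy //.
by rewrite chiO ?mul1r // rmorphB cx cy.
Qed.

(** The trace form is perfect on integral hermitian matrices: an entry outside
    w^k O is detected by a matrix supported on that entry and its transpose. *)
Lemma herm_duality n (k : int) (M : 'M[K]_n) : ct M = M -> ~ mxP k M ->
  exists2 Y : hermmx conj n, herm_ideal (- k) Y & chi (\tr (Y *m M)) != 1.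
Proof.
move=> cM /existsNP[i /existsNP[j PM]]; pose x := M i j.
have w0 := uq_w0 U.
have x0 : x != 0.
  by apply: contra_not_neq PM => x0; rewrite -/x x0 mulr0; exact: O0 U.
have [a [Oe OeV]] := uq_val U x0; set e := w ^ a * x in Oe OeV.
have xE : x = w ^ (- a) * e by rewrite mulrA -expfzDr // addNr expr0z mul1r.
have e0 : e != 0 by apply: contra_neq x0 => e0; rewrite xE e0 mulr0.
have ak : - a < k.
  rewrite ltNge; apply/negP => ka; apply: PM; rewrite -/x; apply: (ideal_le U ka).
  by rewrite /ideal /= opprK.
have [c [cc Oc chic]] := chi_nontriv.
(* chosen so that y x = c / (2 w): the trace then adds this to its conjugate *)
pose y := w ^ (a - 1) * (2^-1 * c * e^-1).
have Py : P (- k) y.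
  apply: (ideal_le U (b := a - 1)); first by lia.
  rewrite -[a - 1]addr0; apply: (idealM U); first exact: ideal_w U _.
  apply: (proj2 (ideal0 O w _)); do 2?[apply: (uq_M U)] => //; exact: (uq_half U).
have yx : y * x = 2^-1 * (w^-1 * c).
  rewrite xE /y mulrACA -expfzDr // addrAC subrr add0r exprN1.
  by rewrite mulfVK // mulrCA.
clearbody y; pose Y : 'M[K]_n := y *: delta_mx j i + conj y *: delta_mx i j.
have cY : ct Y = Y.
  apply/matrixP => a' b'; rewrite !mxE rmorphD !rmorphM !rmorph_nat (uq_conjK U).
  by rewrite [LHS]addrC ![(b' == _) && _]andbC.
have trE a' b' : \tr (delta_mx a' b' *m M) = M b' a'.
  rewrite /mxtrace (bigD1 a') //= big1 => [|i' ia].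
    rewrite addr0 mxE (bigD1 b') //= big1 => [|j' jb].
      by rewrite mxE !eqxx mul1r addr0.
    by rewrite mxE (negPf jb) andbF mul0r.
  by rewrite mxE big1 // => j' _; rewrite mxE (negPf ia) mul0r.
exists (hermmx_of cY) => [a' b'|] /=.
  have Pb z (b : bool) : P (- k) z -> P (- k) (z * b%:R).
    by case: b => Pz; rewrite ?mulr1 // mulr0; exact: subgroup0 (ideal_subgroup U _).
  rewrite !mxE; apply: (subgroupD (ideal_subgroup U (- k))); apply: Pb => //.
  exact: (ideal_conj U).
rewrite mulmxDl -!scalemxAl linearD !linearZ /= !trE.
have -> : M j i = conj x by rewrite -{1}cM !mxE.
rewrite -rmorphM -/x yx rmorphM fmorphV rmorph_nat rmorphM fmorphV (uq_conjw U) cc.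
by rewrite -mulrDl -[2^-1]mul1r -mulrDl -[1 + 1]/(2 : K) divff ?mul1r ?(uq_two U).
Qed.
Lemma ideal_bounded (I : finType) (f : I -> K) :
  exists N : nat, forall i, P (- N%:Z) (f i).
Proof.
have ex i : exists N : nat, P (- N%:Z) (f i).
  have [fi0|fi0] := eqVneq (f i) 0.
    by exists 0%N; rewrite fi0; exact: subgroup0 (ideal_subgroup U _).
  have [k [Ok _]] := uq_val U fi0; exists `|k|%N.
  apply: (ideal_le U (b := - k)); first by lia.
  by rewrite /ideal /= opprK.
pose N i := projT1 (cid (ex i)); exists (\max_i N i)%N => i.
apply: (ideal_le U (b := - (N i)%:Z)); last by rewrite /N; case: cid.
by rewrite lerN2 lez_nat leq_bigmax.
Qed.

Lemma mx_ideal_bounded (I : finType) n (f : I -> 'M[K]_n) :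
  exists N : nat, forall i, mxP (- N%:Z) (f i).
Proof.
have [N NP] := ideal_bounded (fun i : I * ('I_n * 'I_n) => f i.1 i.2.1 i.2.2).
by exists N => i a b; exact: (NP (i, (a, b))).
Qed.

Lemma chi_tr_congr n (X X' Y Y' : 'M[K]_n) :
  ct X = X -> ct X' = X' -> ct Y = Y -> ct Y' = Y' ->
  O (\tr (X *m Y) - \tr (X' *m Y')) -> chi (\tr (X *m Y)) = chi (\tr (X' *m Y')).
Proof. by move=> cX cX' cY cY'; apply: chi_congr; exact: tr_herm. Qed.

(** Orthogonality: translating by a matrix on which the character is nontrivial
    permutes the cosets. *)
Lemma sum_chi n (k : int) (N : nat) c (e : 'I_c -> hermmx conj n) (M : 'M[K]_n) :
  ct M = M -> mxP (- N%:Z) M ->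
  transversal (herm_ideal N%:Z) (herm_ideal (- k)) e ->
  \sum_i chi (\tr (e i *m M)) = if `[< mxP k M >] then c%:R else 0.
Proof.
move=> cM PM eP; have [Se eI eS] := eP; case: asboolP => kM.
  rewrite (eq_bigr (fun=> 1)) ?sumr_const ?card_ord // => i _.
  apply: chiO; first by apply: tr_herm => //; exact: hermmxP.
  by apply/(ideal0 O w); rewrite -(addNr k); exact: ideal_tr (Se i) kM.
have [Y0 PY0 chiY0] := herm_duality cM kM.
have sD := herm_ideal_subgroup n.
have eP' : transversal (herm_ideal N%:Z) (herm_ideal (- k)) (fun i => Y0 + e i).
  split.
  - by move=> i; apply: subgroupD (sD _) PY0 (Se i).
  - by move=> i j; rewrite opprD addrACA subrr add0r => /eI.
  move=> Y PY; have [|i Pi] := eS (Y - Y0); first exact: subgroupB (sD _) PY PY0.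
  by exists i; rewrite opprD addrA.
have chiM Y Y' : chi (\tr ((Y + Y' : hermmx conj n) *m M)) =
    chi (\tr (Y *m M)) * chi (\tr (Y' *m M)).
  have -> : hermmx_val (Y + Y') = hermmx_val Y + hermmx_val Y'.
    exact: (raddfD (\val : hermmx conj n -> _) Y Y').
  by rewrite mulmxDl linearD chiD //; apply: tr_herm => //; exact: hermmxP.
have cst (Y Y' : hermmx conj n) : herm_ideal (- k) Y -> herm_ideal (- k) Y' ->
    herm_ideal N%:Z (Y - Y') -> chi (\tr (Y *m M)) = chi (\tr (Y' *m M)).
  move=> _ _ YY'; apply: chi_tr_congr => //; try exact: hermmxP.
  rewrite -linearB -mulmxBl -hermmxB.
  by apply/(ideal0 O w); rewrite -(subrr N%:Z); exact: ideal_tr.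
have := sum_transversal (sD _) eP eP' cst.
under [in RHS]eq_bigr do rewrite chiM.
rewrite -mulr_sumr => /eqP; rewrite -subr_eq0 -[X in X - _]mul1r -mulrBl mulf_eq0.
by rewrite subr_eq0 eq_sym (negPf chiY0) => /eqP.
Qed.
End Duality.

(** * The integrals as numbers of solutions *)

Section OrbitalIntegral.
Context (K : fieldType) (conj : {rmorphism K -> K}) (O : set K) (w : K) (q : nat).
Hypothesis U : unramified_quadratic conj O w q.
Local Notation ct X := (map_mx conj X^T).
Local Notation mxP := (mx_ideal O w).
Context (R : realType) (chi : K -> R[i]).
Hypothesis chiD : forall x y, conj x = x -> conj y = y -> chi (x + y) = chi x * chi y.
Hypothesis chiO : forall x, conj x = x -> O x -> chi x = 1.
Hypothesis chi_nontriv : exists x, [/\ conj x = x, O x & chi (w^-1 * x) != 1].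
Context (M n : nat).
Local Notation mx_borel := (borel (fun d : nat => @mx_ideal K O w M n d%:Z)).
Local Notation herm_borel := (borel (fun d : nat => @herm_ideal K conj O w n d%:Z)).
Context (mu : {measure set mx_borel -> \bar R}) (nu : {measure set herm_borel -> \bar R}).
Hypotheses (mu_haar : normalized_haar mu) (nu_haar : normalized_haar nu).

Lemma cintegral_indic (S : set 'M[K]_(M, n)) (f : 'M[K]_(M, n) -> R[i]) :
  cintegral mu setT (fun X : mx_borel => f X * ((\1_S X)%:C)%C) =
  cintegral mu (S : set mx_borel) f.
Proof.
rewrite /cintegral; congr (_ +i* _)%C; rewrite [RHS]Rintegral_mkcond;
  apply: eq_Rintegral => X _; rewrite patchE indicE;
  case: (X \in S); case: (f X) => a b /=; by rewrite ?(mulr1, mulr0, subr0, addr0, add0r, oppr0).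
Qed.

(** Only the solutions of A[X] = B modulo w^k survive the integration over
    w^-k V(O), each with the volume of w^-k V(O). *)
Lemma cintegral_congruence (A : 'M[K]_M) (B : 'M[K]_n) (S : set 'M[K]_(M, n)) k t :
  ct A = A -> mxP (-1) A -> ct B = B -> S `<=` mxP 0 ->
  invariant_mod (mxP k.+1%:Z) S ->
  count_mod (mxP k.+1%:Z) [set X | S X /\ mxP k%:Z (ct X *m A *m X - B)] t ->
  cintegral nu (@herm_ideal K conj O w n (- k%:Z)) (fun Y : hermmx conj n =>
    cintegral mu setT (fun X : 'M[K]_(M, n) =>
      chi (\tr (Y *m (ct X *m A *m X - B))) * ((\1_S X)%:C)%C)) =
  q%:R ^+ (k * (n * n)) * t%:R / q%:R ^+ (2 * k.+1 * (M * n)).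
Proof.
move=> cA PA cB SO Sinv CT.
have sI m' n' d' := mx_ideal_subgroup U m' n' d'.
have sD d := herm_ideal_subgroup U n d.
have q0 := residue_gt0 U.
have CO := count_mx U M n 0 k.+1; rewrite add0r in CO.
have [c [e eP]] := count_mod_sub (sI _ _ _) SO Sinv CO.
have [Se eI eS] := eP.
pose G X := ct X *m A *m X - B.
have cG X : ct (G X) = G X by rewrite ctB (ct_quad U _ cA) cB.
have [N NP] := mx_ideal_bounded U (fun i => G (e i)).
(* A[X] modulo w^k only depends on X modulo w^(k+1) *)
have Gcongr X X' : S X -> S X' -> mxP k.+1%:Z (X - X') -> mxP k%:Z (G X - G X').
  move=> SX SX' XX'; rewrite /G opprB addrA subrK.
  have wA : mxP 0 (w *: A).
    by have := mx_ideal_w U (-1) A; rewrite addNr => ->.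
  have := quad_congr U _ wA (SO _ SX') XX'.
  rewrite -!scalemxAr -!scalemxAl -scalerBr -addn1 PoszD (mx_ideal_w U).
  by apply; rewrite -PoszD.
have muN : fine (mu (mxP k.+1%:Z)) = (q%:R ^+ (2 * k.+1 * (M * n)))^-1.
  have := haar_lattice mu_haar (fun d => sI _ _ _) _ CO; rewrite natrX; apply.
  by move=> d; apply: (mx_ideal_le U).
have nuN : fine (nu (@herm_ideal K conj O w n N%:Z)) = (q%:R ^+ (N * (n * n)))^-1.
  have := count_herm_ideal U n 0 N; rewrite add0r => CN.
  have := haar_lattice nu_haar (fun d => sD _) _ CN; rewrite natrX; apply.
  by move=> d Y; apply: (mx_ideal_le U).
pose g (Y : hermmx conj n) := (\sum_i chi (\tr (Y *m G (e i)))) *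
  ((fine (mu (mxP k.+1%:Z)))%:C)%C.
have inner (Y : hermmx conj n) : herm_ideal O w (- k%:Z) Y ->
    cintegral mu setT (fun X : 'M[K]_(M, n) =>
      chi (\tr (Y *m G X)) * ((\1_S X)%:C)%C) = g Y.
  move=> PY; rewrite cintegral_indic.
  apply: (cintegral_transversal (L := fun d : nat => mxP d%:Z) mu_haar _ _ eP) => //.
    by move=> d; apply: (mx_ideal_le U).
  move=> X X' SX SX' XX'; apply: (chi_tr_congr U chiD chiO) => //; try exact: hermmxP.
  rewrite -linearB -mulmxBr; apply/(ideal0 O w); rewrite -(addNr k%:Z).
  exact: (ideal_tr U PY (Gcongr _ _ SX SX' XX')).
have CD := count_herm_ideal U n (- k%:Z) (N + k).
rewrite PoszD addrCA addNr addr0 in CD; have [d dP] := CD; have [Sd _ _] := dP.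
have tr_diff (Y Y' : hermmx conj n) (X : 'M[K]_n) :
    \tr (Y *m X) - \tr (Y' *m X) = \tr (hermmx_val (Y - Y') *m X).
  by rewrite hermmxB mulmxBl linearB.
have gconst (Y Y' : hermmx conj n) : herm_ideal O w (N%:Z) (Y - Y') -> g Y = g Y'.
  move=> YY'; rewrite /g; congr (_ * _); apply: eq_bigr => i _.
  apply: (chi_tr_congr U chiD chiO) => //; try exact: hermmxP.
  by rewrite tr_diff; apply/(ideal0 O w); rewrite -(subrr N%:Z); exact: (ideal_tr U YY' (NP i)).
rewrite (cintegral_transversal (L := fun d : nat => herm_ideal O w d%:Z) nu_haar _ _ dP);
  first last.
- by move=> Y Y' PY PY' YY'; rewrite !inner //; exact: gconst.
- move=> Y Y' PY YY'; rewrite -(subrK Y Y'); apply: (subgroupD (sD _)) PY.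
  by apply: (mx_ideal_le U) YY'; lia.
- by move=> d' Y; apply: (mx_ideal_le U).
- by move=> d'; exact: sD.
under eq_bigr do rewrite inner //.
rewrite -mulr_suml exchange_big /=.
have sumE i := sum_chi U chiD chiO chi_nontriv (cG (e i)) (NP i) dP.
under eq_bigr do rewrite sumE.
have -> : \sum_(i < c) (if `[< mxP k%:Z (G (e i)) >] then (q ^ ((N + k) * (n * n)))%:R else 0)
    = t%:R * q%:R ^+ ((N + k) * (n * n)) :> R[i].
  rewrite -big_mkcond /= sumr_const -[LHS]mulr_natl natrX; congr (_%:R * _).
  apply: (count_mod_unique (sI _ _ _)) CT.
  pose I : finType := {i : 'I_c | `[< mxP k%:Z (G (e i)) >]}.
  have -> : #|[pred i | `[< mxP k%:Z (G (e i)) >]]| = #|I| by rewrite card_sig.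
  apply: (@transversal_count _ _ _ I (fun i => e (val i))); split.
  - by case=> i /= /asboolP.
  - by move=> i j /eI /val_inj.
  move=> X [SX GX]; have [i Li] := eS _ SX.
  suff Pi : `[< mxP k%:Z (G (e i)) >] by exists (exist _ i Pi).
  apply/asboolP; rewrite -(subrK (G X) (G (e i))).
  apply: (subgroupD (sI _ _ _)) GX; apply: Gcongr => //.
  exact: (subgroup_sym (sI _ _ _)).
rewrite muN nuN mulnDl exprD.
have qR : (q%:R : R) != 0 by rewrite pnatr_eq0 -lt0n.
have qC : (q%:R : R[i]) != 0 by rewrite pnatr_eq0 -lt0n.
rewrite !fmorphV !rmorphXn !rmorph_nat.
by field; rewrite !expf_neq0.
Qed.
End OrbitalIntegral.

(** * Limits and derivatives of proportional sequences *)

Section Limits.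
Context (R : realType).
Local Notation C := R[i].

(** If u diverges then so does c u, and both limits have the default value 0. *)
Lemma climitZ (c : C) (u : nat -> C) : c != 0 ->
  climit (fun k => c * u k) = c * climit u.
Proof.
move=> c0; rewrite /climit.
have E := @is_cvgZlE C (C^o : normedModType C) nat \oo _ c (u : nat -> C^o) c0.
case: (pselect (cvg ((u : nat -> C^o) @ \oo))) => [cu|ncu].
  exact: (@limZl_tmp C (C^o : normedModType C) nat \oo _ c (u : nat -> C^o) cu).
have u0 : limn (u : nat -> C^o) = 0 by exact: (dvgP ncu).
have cu0 : limn ((fun k => c * u k) : nat -> C^o) = 0.
  by apply: dvgP => cu; apply: ncu; rewrite -E.
by rewrite u0 mulr0; exact: cu0.
Qed.

Lemma climit_eq (u v : nat -> C) : u =1 v -> climit u = climit v.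
Proof. by move=> /funext ->. Qed.

Lemma climit0 : climit (fun=> 0 : C) = 0.
Proof. exact: (@lim_cst (C^o : normedModType C)). Qed.

Context (q : nat) (q1 : (1 < q)%N).

Lemma expNq_inj : injective (fun r : nat => (- q%:R : C) ^- (2 * r)).
Proof.
move=> r s /invr_inj; rewrite !exprM sqrrN -!natrX => /eqP.
by rewrite eqr_nat -!expnM eqn_exp2l // eqn_mul2l /= => /eqP.
Qed.

Lemma poly_in_xE (f : nat -> C) (P : {poly C}) :
  (forall r, f r = P.[(- q%:R) ^- (2 * r)]) -> poly_in_x q f = P.
Proof.
move=> fP; apply: xget_unique => // Q fQ; apply/eqP; rewrite -subr_eq0.
pose rs := [seq (- q%:R : C) ^- (2 * r) | r <- iota 0 (size (Q - P))].
apply/eqP; apply: (@roots_geq_poly_eq0 _ _ rs).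
- apply/allP => _ /mapP[r _ ->]; rewrite /root hornerD hornerN.
  by rewrite -fQ -fP subrr.
- by rewrite map_inj_uniq ?iota_uniq //; exact: expNq_inj.
- by rewrite size_map size_iota.
Qed.

(** If the values of f are not given by a polynomial then those of c f are not
    either, and both derivatives are that of the default 0. *)
Lemma neg_deriv_at1Z (c : C) (f : nat -> C) : c != 0 ->
  neg_deriv_at1 q (fun r => c * f r) = c * neg_deriv_at1 q f.
Proof.
move=> c0; rewrite /neg_deriv_at1.
suff -> : poly_in_x q (fun r => c * f r) = c *: poly_in_x q f.
  by rewrite derivZ hornerZ mulrN.
case: (pselect (exists P : {poly C}, forall r : nat, f r = P.[(- q%:R) ^- (2 * r)])).
  move=> [P fP]; rewrite (poly_in_xE fP); apply: poly_in_xE => r.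
  by rewrite hornerZ fP.
move=> nP; rewrite /poly_in_x !xgetPN ?scaler0 // => P.
- by move=> fP; apply: nP; exists P.
- move=> fP; apply: nP; exists (c^-1 *: P) => r.
  by rewrite hornerZ -fP mulKf.
Qed.

Lemma eq_neg_deriv_at1 (f g : nat -> C) : f =1 g ->
  neg_deriv_at1 q f = neg_deriv_at1 q g.
Proof. by move=> /funext ->. Qed.
End Limits.

(** * The functions W *)

Section PadicSetting.
Context (p : nat) (hp : prime p) (F : fieldExtType (padic hp)) (E : fieldExtType F)
  (conj : {rmorphism E -> E}) (pi : F) (q : nat).
Local Notation OE := (ext_integers E).
Local Notation w := (pi%:A : E).
Hypothesis U : unramified_quadratic conj OE w q.
Hypothesis conj_F : forall a : F, conj a%:A = a%:A.
Hypothesis fixed_F : forall x : E, conj x = x -> exists a : F, x = a%:A.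
Local Notation ct X := (map_mx conj X^T).
Local Notation mxP := (mx_ideal OE w).

Lemma to_base_in_alg (a : F) : to_base (a%:A : E) = a.
Proof.
apply: xget_unique => // b ba; exact: (fmorph_inj (in_alg E)).
Qed.

Context (R : realType) (psi : F -> R[i])
  (psiD : forall x y : F, psi (x + y) = psi x * psi y)
  (psi_int : forall x : F, base_integers F x -> psi x = 1)
  (psi_nontriv : exists2 x : F, base_integers F x & psi (pi^-1 * x) != 1).
Let chi (x : E) := psi (to_base x).

Lemma chi_additive x y : conj x = x -> conj y = y -> chi (x + y) = chi x * chi y.
Proof.
move=> /fixed_F[a ->] /fixed_F[b ->]; rewrite /chi -scalerDl !to_base_in_alg.
exact: psiD.
Qed.

Lemma chi_integral x : conj x = x -> OE x -> chi x = 1.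
Proof.
move=> /fixed_F[a ->] /ext_integers_base Oa; rewrite /chi to_base_in_alg.
exact: psi_int.
Qed.

Lemma chi_uniformizer : exists x, [/\ conj x = x, OE x & chi (w^-1 * x) != 1].
Proof.
have [x Ox px] := psi_nontriv; exists x%:A; split.
- exact: conj_F.
- exact/ext_integers_base.
have -> : w^-1 * x%:A = (pi^-1 * x)%:A.
  by rewrite -[_%:A in RHS]/(in_alg E _) rmorphM fmorphV.
by rewrite /chi to_base_in_alg.
Qed.

Context (n : nat)
  (mu : forall r : nat,
    {measure set (mx_borel E pi (n + n + 2 * r) (n + n)) -> \bar R})
  (mu_haar : forall r : nat, normalized_haar (mu r))
  (nu : {measure set (herm_borel conj pi (n + n)) -> \bar R})
  (nu_haar : normalized_haar nu).

Definition form_row t r : 'rV[E]_(n + n + 2 * r) :=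
  \row_i if (n + n - t <= i < n + n)%N then w^-1 else 1.

Lemma add_unit_formE t r :
  add_unit_form (At E pi n t) r = diag_mx (form_row t r).
Proof.
apply/matrixP => i j; rewrite /add_unit_form /form_row !mxE.
case: (split_ordP i) => i' ->; case: (split_ordP j) => j' ->.
- rewrite row_mxEl mxE (inj_eq (@lshift_inj _ _)) /= andbT.
  by case: eqP => [->|_]; rewrite ?mulr0n ?mulr1n //= ltnNge; case: leqP.
- by rewrite row_mxEr mxE eq_lrshift.
- by rewrite row_mxEl mxE eq_rlshift.
by rewrite row_mxEr mxE (inj_eq (@rshift_inj _ _)) andbF.
Qed.

Lemma supp_invariant h t r k : invariant_mod (mxP k.+1%:Z) (@supp _ _ _ E pi n h t r).
Proof.
move=> X Y [OX SX] XY; split.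
  exact: (mx_ideal_congr U (d := k.+1%:Z)) OX XY.
move=> i j hi hj; rewrite -(subrK (X i j) (Y i j)) mulrDr.
apply: (OD U); last exact: SX.
have := XY i j; rewrite !mxE => Oij.
by have := ideal_le U (a := 1) (b := k.+1%:Z) isT Oij; rewrite /ideal /= exprN1.
Qed.

(** The k-th term of the limit defining W: the case of [cintegral_congruence] of
    the form A_t and the support of 1_{h,t}. *)
Lemma W_term h t r B k c : ct B = B ->
  count_mod (mxP k.+1%:Z) [set X | @supp _ _ _ E pi n h t r X /\
     mxP k%:Z (ct X *m diag_mx (form_row t r) *m X - B)] c ->
  cintegral nu (herm_lattice (conj := conj) pi (- k%:Z)) (fun Y : hermmx conj (n + n) =>
      cintegral (mu r) setT (fun X : 'M[E]_(n + n + 2 * r, n + n) =>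
        psi (herm_pairing Y
               (herm_act conj (add_unit_form (At E pi n t) r) X - B))
        * (\1_(@supp _ _ _ E pi n h t r) X)%:C%C)) =
  q%:R ^+ (k * ((n + n) * (n + n))) * c%:R /
  q%:R ^+ (2 * k.+1 * ((n + n + 2 * r) * (n + n))).
Proof.
move=> cB; rewrite add_unit_formE => CT.
apply: (cintegral_congruence U chi_additive chi_integral chi_uniformizer
  (mu_haar r) nu_haar _ _ cB _ _ CT).
- rewrite tr_diag_mx map_diag_mx /form_row; congr diag_mx; apply/rowP => i; rewrite !mxE.
  by case: ifP => _; rewrite ?rmorph1 // fmorphV (uq_conjw U).
- move=> i j; rewrite !mxE opprK expr1z.
  case: eqP => _; last by rewrite mulr0n mulr0; exact: O0 U.
  rewrite mulr1n; case: ifP => _; last by rewrite mulr1; exact: (uq_w U).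
  by rewrite divff ?(uq_w0 U) //; exact: (uq_1 U).
- by move=> X [].
- exact: supp_invariant.
Qed.

Variable B1 : 'M[E]_n.
Hypothesis cB1 : ct B1 = B1.
Let B : 'M[E]_(n + n) := block_mx B1 0 0 (w^-1)%:M.

Lemma split_herm : ct B = B.
Proof.
rewrite tr_block_mx map_block_mx !trmx0 !map_mx0 cB1 tr_scalar_mx map_scalar_mx.
by rewrite fmorphV (uq_conjw U).
Qed.

Lemma card_rows t N : (#|[pred i : 'I_N | (n + n - t <= i < n + n)%N]| <= t)%N.
Proof.
have -> : #|[pred i : 'I_N | (n + n - t <= i < n + n)%N]| =
    size (map val (enum [pred i : 'I_N | (n + n - t <= i < n + n)%N])).
  by rewrite size_map -cardE.
have -> : t = size (iota (n + n - t) t) by rewrite size_iota.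
apply: uniq_leq_size => [|_ /mapP[i + ->]].
  by rewrite map_inj_uniq ?enum_uniq //; exact: val_inj.
by rewrite mem_enum size_iota mem_iota inE => /andP[-> /=]; lia.
Qed.

(** The lower right block of B is w^-1, while the rows of X with weight w^-1 only
    contribute a Gram matrix of rank at most t. *)
Lemma W_vanish h t r : (t < n)%N -> W psi mu nu h t B r = 0.
Proof.
move=> tn; rewrite /W -(climit0 R); apply: climit_eq => k.
pose rows := [pred i : 'I_(n + n + 2 * r) | (n + n - t <= i < n + n)%N].
rewrite (@W_term _ _ _ _ _ 0 split_herm) ?mulr0 ?mul0r //.
suff -> : [set X | @supp _ _ _ E pi n h t r X /\
    mxP k%:Z (ct X *m diag_mx (form_row t r) *m X - B)] = set0.
  by exists (fun=> 0); split => [[]|[]|] //.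
rewrite -subset0 => X [[OX _] PX].
have w0 := uq_w0 U.
pose Y : 'M[E]_(#|rows|, n) := \matrix_(s, b) X (enum_val s) (rshift n b).
apply: (@gram_not_congr1 _ _ _ _ _ U _ _ Y).
  exact: leq_ltn_trans (card_rows t _) tn.
move=> a b; pose f j := conj (X j (rshift n a)) * X j (rshift n b).
have Of j : OE (f j).
  apply: (uq_M U); last by apply/(ideal0 OE w)/OX.
  by apply: (uq_conj U); apply/(ideal0 OE w)/OX.
have gramE : (ct Y *m Y) a b = \sum_(j in rows) f j.
  by rewrite mxE [RHS]big_enum_val; apply: eq_bigr => s _; rewrite !mxE.
have quadE : (ct X *m diag_mx (form_row t r) *m X) (rshift n a) (rshift n b) =
    w^-1 * (\sum_(j in rows) f j) + \sum_(j | j \notin rows) f j.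
  rewrite mxE (bigID (mem rows)) /= mulr_sumr; congr (_ + _); apply: eq_bigr => j.
    by rewrite inE mul_mx_diag !mxE => ->; rewrite mulrAC mulrC.
  by rewrite inE mul_mx_diag !mxE => /negPf ->; rewrite mulr1.
have := PX (rshift n a) (rshift n b).
have BE : B (rshift n a) (rshift n b) = w^-1 *+ (a == b).
  by rewrite /B block_mxEdr mxE.
rewrite mxE quadE [X in _ + X]mxE BE.
move=> /(ideal_le U (a := 0) (b := k%:Z) isT)/(ideal0 OE w) Oab.
have GE : (ct Y *m Y - 1%:M) a b = \sum_(j in rows) f j - (a == b)%:R.
  by rewrite mxE gramE; congr (_ + _); rewrite !mxE.
rewrite GE exprN1 mulrBr mulr_natr.
have := uq_B U Oab (_ : OE (\sum_(j | j \notin rows) f j)).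
rewrite addrAC addrK; apply.
by apply: (big_ind OE) => [|x y|j _]; [exact: O0 U | exact: OD U x y | exact: Of].
Qed.

Lemma At_split : At E pi n n = block_mx 1%:M 0 0 (w^-1)%:M.
Proof.
apply/matrixP => i j; rewrite /At mxE addnK.
case: (split_ordP i) => i' ->; case: (split_ordP j) => j' ->.
- by rewrite block_mxEul mxE (inj_eq (@lshift_inj _ _)) /= ?ltn_ord; case: eqP.
- by rewrite block_mxEur mxE eq_lrshift.
- by rewrite block_mxEdl mxE eq_rlshift.
rewrite block_mxEdr mxE (inj_eq (@rshift_inj _ _)) /= ?ltnNge ?leq_addr /=.
by case: eqP.
Qed.

Lemma supp_split r (X : 'M[E]_(n + n + 2 * r, n + n)) :
  @supp _ _ _ E pi n n n r X <-> mxP 0 X /\ mxP 1 (part_Q X).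
Proof.
split=> -[OX SX]; split=> // i j.
  have := SX (lshift _ (rshift n i)) (lshift n j).
  rewrite /part_Q !mxE addnK exprN1 /= leq_addr ltn_add2l !ltn_ord.
  by apply.
rewrite addnK => /andP[ni inn] jn.
have il : (i - n < n)%N by lia.
have := SX (Ordinal il) (Ordinal jn); rewrite /part_Q !mxE exprN1.
have -> : lshift (2 * r) (rshift n (Ordinal il)) = i.
  by apply: val_inj => /=; rewrite subnKC.
by have -> : lshift n (Ordinal jn) = j by exact: val_inj.
Qed.

(** The exponents of q: the volume of w^-k V(O) contributes 4 k n^2, that of a
    class of X the denominator, and [count_split_reps] the rest. Beyond the
    normalization of alpha only the constant - 4 n^2 is left. *)
Lemma W_split_term r k s a :
  count_mod (@mx_ideal _ OE w n n k.+1%:Z) (represents conj OE w 1%:M 1%:M k.+1%:Z)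
    (s * q ^ (k * (n * n))) ->
  count_mod (@mx_ideal _ OE w (n + 2 * r) n k%:Z)
    (represents conj OE w 1%:M B1 k%:Z) a ->
  cintegral nu (herm_lattice (conj := conj) pi (- k%:Z)) (fun Y : hermmx conj (n + n) =>
      cintegral (mu r) setT (fun X : 'M[E]_(n + n + 2 * r, n + n) =>
        psi (herm_pairing Y
               (herm_act conj (add_unit_form (At E pi n n) r) X - B))
        * (\1_(@supp _ _ _ E pi n n n r) X)%:C%C)) =
  s%:R / q%:R ^+ (n * n * 4) *
  (q%:R ^ (- (k%:Z * n%:Z * (2 * (n + 2 * r)%N%:Z - n%:Z))) * a%:R).
Proof.
move=> Cs Ca; have CT := count_split_reps U cB1 Cs Ca.
rewrite (W_term (h := n) split_herm (c := (q ^ (2 * k.+1 * ((n + 2 * r) * n)) *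
  (s * q ^ (k * (n * n)) * (a * q ^ (2 * 1 * ((n + 2 * r) * n)))))%N)); last first.
  rewrite -add_unit_formE /add_unit_form At_split.
  suff -> : [set X : 'M[E]_(n + n + 2 * r, n + n) | @supp _ _ _ E pi n n n r X /\
      mxP k%:Z (ct X *m block_mx (block_mx 1%:M 0 0 (w^-1)%:M) 0 0 1%:M *m X - B)]
    = split_reps conj OE w B1 k%:Z by exact: CT.
  apply/seteqP; split=> X /=.
    by move=> [/supp_split[OX QX] PX].
  by move=> [OX QX PX]; split=> //; exact/supp_split.
have qC : (q%:R : R[i]) != 0.
  by rewrite pnatr_eq0 -lt0n; apply: (residue_gt0 U).
set m := (n + 2 * r)%N.
have -> : - (k%:Z * n%:Z * (2 * m%:Z - n%:Z)) =
    (k * (n * n))%N%:Z - (k * (m * n) * 2)%N%:Z.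
  by rewrite !PoszM; ring.
rewrite expfzDr // -exprnN -exprnP.
have -> : (k * ((n + n) * (n + n)) = k * (n * n) * 4)%N by ring.
have -> : (2 * k.+1 * (m * n) = k * (m * n) * 2 + m * n * 2)%N by ring.
have -> : (2 * k.+1 * ((n + n + 2 * r) * (n + n)) =
    k * (m * n) * 4 + k * (n * n) * 4 + m * n * 4 + n * n * 4)%N by rewrite /m; ring.
have -> : (2 * 1 * (m * n) = m * n * 2)%N by ring.
rewrite !natrM !natrX !exprD !exprM.
by field; rewrite !expf_neq0.
Qed.

Lemma W_split_limit r s :
  (forall k : nat, count_mod (@mx_ideal _ OE w n n k.+1%:Z)
     (represents conj OE w 1%:M 1%:M k.+1%:Z) (s * q ^ (k * (n * n)))) ->
  (0 < s)%N ->
  W psi mu nu n n B r = s%:R / q%:R ^+ (n * n * 4) *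
    alpha conj pi q R (1%:M : 'M[E]_(n + 2 * r)) B1.
Proof.
move=> Cs s0; have q0 : (q%:R : R[i]) != 0.
  by rewrite pnatr_eq0 -lt0n; apply: (residue_gt0 U).
rewrite /alpha -climitZ; last first.
  by rewrite mulf_neq0 ?invr_eq0 ?expf_neq0 // pnatr_eq0 -lt0n.
apply: climit_eq => k.
have [a Ca] := count_represents_exists U B1 (lexx k%:Z)
  (@mx_ideal_1 _ _ _ _ _ U (n + 2 * r)).
rewrite (W_split_term (Cs k) Ca); congr (_ * (_ * _%:R)).
exact/esym/(card_cosets (mx_ideal_subgroup U _ _ _) Ca).
Qed.
End PadicSetting.

Theorem theorem3p19
  (* the odd prime p, F / Q_p finite unramified, E / F unramified quadratic *)
  (p : nat) (hp : prime p) (p_odd : odd p)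
  (F : fieldExtType (padic hp)) (E : fieldExtType F)
  (unramF : unramified (padic_integers hp) (base_integers F))
  (unramE : unramified (base_integers F) (ext_integers E))
  (quadE : \dim {:E} = 2%N)
  (* uniformizer and residue field of F *)
  (pi : F) (unif_pi : uniformizer (base_integers F) pi)
  (q : nat) (card_q : (residue_field (base_integers F) #= `I_q)%card)
  (* the nontrivial automorphism of E / F *)
  (conj : {rmorphism E -> E}) (conj_F : forall a : F, conj a%:A = a%:A)
  (conj_nontriv : exists x : E, conj x != x)
  (* the additive character psi *)
  (R : realType) (psi : F -> R[i])
  (psi_neq0 : forall x : F, psi x != 0)
  (psiD : forall x y : F, psi (x + y) = psi x * psi y)
  (psi_int : forall x : F, base_integers F x -> psi x = 1)
  (psi_nontriv : exists2 x : F, base_integers F x & psi (pi^-1 * x) != 1)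
  (* normalized Haar measures on M_{2n+2r,2n}(E) and V_{2n}(E) *)
  (n : nat) (n_ge1 : (1 <= n)%N)
  (mu : forall r : nat,
    {measure set (mx_borel E pi (n + n + 2 * r) (n + n)) -> \bar R})
  (mu_haar : forall r : nat, normalized_haar (mu r))
  (nu : {measure set (herm_borel conj pi (n + n)) -> \bar R})
  (nu_haar : normalized_haar nu)
  (B1 : 'M[E]_n) (B1_herm : nondeg_herm conj B1) :
  let B : 'M[E]_(n + n) := block_mx B1 0 0 (pi%:A^-1)%:M in
  J q psi mu nu (mid_ord n) B =
    (W psi mu nu n n (At E pi n n) 0)^-1 *
      (W' q psi mu nu n n B
       - \sum_(i < n) beta q psi mu nu (mid_ord n) i * W psi mu nu n i B 0) /\
  (W psi mu nu n n (At E pi n n) 0)^-1 *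
      (W' q psi mu nu n n B
       - \sum_(i < n) beta q psi mu nu (mid_ord n) i * W psi mu nu n i B 0) =
    alpha' conj pi q R (1%:M : 'M[E]_n) B1 /
      alpha conj pi q R (1%:M : 'M[E]_n) (1%:M : 'M[E]_n).
Proof.
move=> B; split; first by [].
have U := integers_unramified_quadratic p_odd unramF unramE quadE unif_pi card_q
  conj_F conj_nontriv.
have fixed_F := conj_fixed quadE conj_F conj_nontriv.
have cB1 : (map_mx conj B1^T) = B1.
  by have [/sesquiP + _] := B1_herm; rewrite expr0 scale1r.
have c11 : map_mx conj (1%:M : 'M[E]_n)^T = 1%:M by rewrite trmx1 map_mx1.
have [s s0 Cs] := count_unitary U n.
have q0 : (q%:R : R[i]) != 0.
  by rewrite pnatr_eq0 -lt0n; apply: (residue_gt0 U).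
pose c : R[i] := s%:R / q%:R ^+ (n * n * 4).
have c0 : c != 0 by rewrite mulf_neq0 ?invr_eq0 ?expf_neq0 // pnatr_eq0 -lt0n.
have W0 (i : 'I_n) : W psi mu nu n i B 0 = 0.
  by apply: (W_vanish U conj_F fixed_F psiD psi_int psi_nontriv mu_haar nu_haar cB1); exact: ltn_ord.
have WE r : W psi mu nu n n B r = c * alpha conj pi q R (add_unit_form (1%:M : 'M[E]_n) r) B1.
  rewrite (W_split_limit U conj_F fixed_F psiD psi_int psi_nontriv mu_haar nu_haar cB1 _ Cs s0).
  by rewrite /add_unit_form -scalar_mx_block.
(* A_n is diag(1, 1/w), the matrix B for B1 = 1. *)
have WA : W psi mu nu n n (At E pi n n) 0 =
    c * alpha conj pi q R (1%:M : 'M[E]_n) (1%:M : 'M[E]_n).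
  rewrite At_split (W_split_limit U conj_F fixed_F psiD psi_int psi_nontriv mu_haar nu_haar c11 _ Cs s0).
  congr (_ * _).
  have : forall m, m = n -> alpha conj pi q R (1%:M : 'M[E]_m) (1%:M : 'M[E]_n) =
      alpha conj pi q R (1%:M : 'M[E]_n) (1%:M : 'M[E]_n) by move=> m ->.
  by apply; rewrite muln0 addn0.
rewrite big1 ?subr0; last by move=> i _; rewrite W0 mulr0.
rewrite WA /W' (eq_neg_deriv_at1 q WE) (neg_deriv_at1Z (residue_gt1 U)) //.
by rewrite invfM mulrACA mulVf // mul1r mulrC.
Qed.
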